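(* Let $\mathcal{A}$ be a computable equivalence structure. (1) If $\mathcal{A}$ has bounded character and finitely many infinite equivalence classes, then its degree of bi-embeddable categoricity is $\mathbf{0}$. (2) If $\mathcal{A}$ has unbounded character and finitely many infinite equivalence classes, then its degree of bi-embeddable categoricity is $\mathbf{0}'$. (3) If $\mathcal{A}$ has infinitely many infinite equivalence classes, then its degree of bi-embeddable categoricity is $\mathbf{0}''$. Thus the degree of bi-embeddable categoricity of a computable equivalence structure is $\mathbf{0}$, $\mathbf{0}'$, or $\mathbf{0}''$. Furthermore, these degrees of bi-embeddable categoricity are strong.
   Context: An equivalence structure $\mathcal{A}=(A,E)$ has universe $A\subseteq\omega$ and an equivalence relation $E$ on $A$; it is computable if $A$ is computable and its atomic diagram is computable. Two structures are bi-embeddable if each embeds into the other; a structure bi-embeddable with $\mathcal{A}$ is a bi-embeddable copy of $\mathcal{A}$. $\mathcal{A}$ has bounded character if there is a finite $k$ such that all finite equivalence classes of $\mathcal{A}$ have size at most $k$; otherwise it has unbounded character. The degree of bi-embeddable categoricity of a computable structure $\mathcal{A}$ is the least Turing degree $\mathbf{d}$ (if it exists) such that for any two computable bi-embeddable copies of $\mathcal{A}$, $\mathbf{d}$ computes embeddings between them in both directions. It is the strong degree of bi-embeddable categoricity if, in addition, $\mathcal{A}$ has two computable bi-embeddable copies $\mathcal{A}_0,\mathcal{A}_1$ such that for all embeddings $\mu:\mathcal{A}_0\hookrightarrow\mathcal{A}_1$ and $\nu:\mathcal{A}_1\hookrightarrow\mathcal{A}_0$, $\mu\oplus\nu\geq_T\mathbf{d}$.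 *)

(* Defs.v *)
From Stdlib Require Import Arith List Cantor.
Import ListNotations.

(* An oracle is a (functional, total) relation O x y : "O(x) = y". *)
Definition oracle := nat -> nat -> Prop.

(* Programs are natural numbers: of_nat e = (tag, payload).
   tag 0: zero, 1: successor, 2: identity, 3: first projection of the
   Cantor pair, 4: second projection, 5 (f,g): x |-> <f x, g x>,
   6 (f,g): composition f o g, 7 (f,g): primitive recursion
   h<x,0> = f x, h<x,n+1> = g<x,<n,h<x,n>>>, 8 f: minimisation
   x |-> mu n. f<x,n> = 0, 9: oracle query.  Other tags: nowhere defined. *)
Inductive eval (O : oracle) : nat -> nat -> nat -> Prop :=
| ev_zero e p x : of_nat e = (0, p) -> eval O e x 0
| ev_succ e p x : of_nat e = (1, p) -> eval O e x (S x)
| ev_id e p x : of_nat e = (2, p) -> eval O e x x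
| ev_fst e p x : of_nat e = (3, p) -> eval O e x (fst (of_nat x))
| ev_snd e p x : of_nat e = (4, p) -> eval O e x (snd (of_nat x))
| ev_pair e p f g x y z : of_nat e = (5, p) -> of_nat p = (f, g) ->
    eval O f x y -> eval O g x z -> eval O e x (to_nat (y, z))
| ev_comp e p f g x y z : of_nat e = (6, p) -> of_nat p = (f, g) ->
    eval O g x y -> eval O f y z -> eval O e x z
| ev_rec0 e p f g x y : of_nat e = (7, p) -> of_nat p = (f, g) ->
    eval O f x y -> eval O e (to_nat (x, 0)) y
| ev_recS e p f g x n z y : of_nat e = (7, p) -> of_nat p = (f, g) ->
    eval O e (to_nat (x, n)) z -> eval O g (to_nat (x, to_nat (n, z))) y ->
    eval O e (to_nat (x, S n)) y
| ev_min e f x n : of_nat e = (8, f) -> eval O f (to_nat (x, n)) 0 ->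
    (forall m, m < n -> exists k, eval O f (to_nat (x, m)) (S k)) ->
    eval O e x n
| ev_oracle e p x y : of_nat e = (9, p) -> O x y -> eval O e x y.

Definition set_oracle (X : nat -> Prop) : oracle :=
  fun x y => (X x /\ y = 1) \/ (~ X x /\ y = 0).
Definition join_oracle (f g : nat -> nat) : oracle :=
  fun n y => (n mod 2 = 0 /\ f (n / 2) = y) \/ (n mod 2 = 1 /\ g (n / 2) = y).

Definition T_red (A : nat -> Prop) (O : oracle) : Prop :=
  exists e, forall x, (A x -> eval O e x 1) /\ (~ A x -> eval O e x 0).

Definition computes (O : oracle) (f : nat -> nat) : Prop :=
  exists e, forall x, eval O e x (f x).

Definition empty_set : nat -> Prop := fun _ => False.
Definition computable_set (A : nat -> Prop) : Prop := T_red A (set_oracle empty_set).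

Definition jump (X : nat -> Prop) : nat -> Prop :=
  fun n => exists y, eval (set_oracle X) (fst (of_nat n)) (snd (of_nat n)) y.

Definition zero' := jump empty_set.
Definition zero'' := jump zero'.

Record structure := Struct { dom : nat -> Prop; rel : nat -> nat -> Prop }.

Definition computable_structure (A : structure) : Prop :=
  computable_set (dom A) /\
  computable_set (fun n => rel A (fst (of_nat n)) (snd (of_nat n))).

Definition equivalence_structure (A : structure) : Prop :=
  (forall x y, rel A x y -> dom A x /\ dom A y) /\
  (forall x, dom A x -> rel A x x) /\
  (forall x y, rel A x y -> rel A y x) /\
  (forall x y z, rel A x y -> rel A y z -> rel A x z).

(* f (a total function on ω, only its values on dom A matter) is an
   embedding of A into B. *)
Definition embedding (A B : structure) (f : nat -> nat) : Prop :=
  (forall x, dom A x -> dom B (f x)) /\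
  (forall x y, dom A x -> dom A y -> f x = f y -> x = y) /\
  (forall x y, dom A x -> dom A y -> (rel A x y <-> rel B (f x) (f y))).

Definition embeds (A B : structure) : Prop := exists f, embedding A B f.
Definition bi_embeddable (A B : structure) : Prop := embeds A B /\ embeds B A.

Definition eq_class (A : structure) (x : nat) : nat -> Prop :=
  fun y => dom A y /\ rel A x y.

Definition finite_set (P : nat -> Prop) : Prop :=
  exists l : list nat, forall y, P y -> In y l.
Definition card_le (P : nat -> Prop) (k : nat) : Prop :=
  exists l : list nat, length l <= k /\ forall y, P y -> In y l.

Definition bounded_character (A : structure) : Prop :=
  exists k, forall x, dom A x -> finite_set (eq_class A x) -> card_le (eq_class A x) k.

Definition finitely_many_infinite_classes (A : structure) : Prop :=
  exists l : list nat, forall x, dom A x -> ~ finite_set (eq_class A x) ->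
    exists r, In r l /\ rel A x r.

Definition computes_biemb (A : structure) (X : nat -> Prop) : Prop :=
  forall B C, computable_structure B -> computable_structure C ->
    bi_embeddable B A -> bi_embeddable C A ->
    (exists f, computes (set_oracle X) f /\ embedding B C f) /\
    (exists g, computes (set_oracle X) g /\ embedding C B g).

Definition BE_cat_degree (A : structure) (X : nat -> Prop) : Prop :=
  computes_biemb A X /\ forall Y, computes_biemb A Y -> T_red X (set_oracle Y).

Definition strong_BE_cat_degree (A : structure) (X : nat -> Prop) : Prop :=
  BE_cat_degree A X /\
  exists A0 A1, computable_structure A0 /\ computable_structure A1 /\
    bi_embeddable A0 A /\ bi_embeddable A1 A /\
    forall mu nu, embedding A0 A1 mu -> embedding A1 A0 nu ->
      T_red X (join_oracle mu nu).

(* Main.v *)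
(* Every copy is embedded greedily: [f x] is the least element compatible with the finite part
   of [f] built so far, where a class met for the first time goes to a fresh class that is large
   enough. Finitely many classes (the infinite ones or, for bounded character, those larger than
   every size occurring infinitely often) are matched beforehand, and only recognizing "large
   enough" needs an oracle: counting up to a constant (bounded character), bounding the
   size of a finite class (Pi1, unbounded character), or recognizing an infinite class (Pi2).

   For the lower bounds, a computable copy whose class [e] outgrows the halting time of [e] forces
   an embedding into a copy with known class sizes to bound halting times. In the last case the
   infinite classes of a suitable copy are indexed by the initial segments of a sequence of
   canonical witnesses for membership in [zero''] (a Sigma2 set), so an embedding, which must
   list infinitely many of them, computes [zero'']. *)

Require Import Defs.
From Stdlib Require Import Arith List Cantor FinFun Lia Classical ClassicalEpsilon.
Import ListNotations.

Arguments to_nat : simpl never.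
Arguments of_nat : simpl never.

Notation "⟨ a , b ⟩" := (to_nat (a, b)).
Notation pr1 n := (fst (of_nat n)).
Notation pr2 n := (snd (of_nat n)).
Notation dec := excluded_middle_informative.

(** Two obstacles shape the upper bounds. And, as long as only finite bounds matter, the test for a
    large enough target should not be a Sigma1 question: the candidate [y] itself serves as the
    stage up to which its class is counted, and every class with [m] elements contains a [y] that
    passes. The classes matched beforehand are finite information wired into the program, so it does
    not matter how they were found. In the lower bound for [zero''], one coded class per number
    would not do: an embedding chooses which infinite classes it hits and could avoid any given one.
    Initial segments make every infinite family of indices informative. Since [eval] carries no
    clock, halting times are measured on an abstract machine, whose oracle can also be replaced by
    approximations. *)

Lemma pr1_pair a b : pr1 ⟨a, b⟩ = a.
Proof. now rewrite cancel_of_to. Qed.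

Lemma pr2_pair a b : pr2 ⟨a, b⟩ = b.
Proof. now rewrite cancel_of_to. Qed.

Lemma pair_pr n : ⟨pr1 n, pr2 n⟩ = n.
Proof. rewrite <- surjective_pairing. apply cancel_to_of. Qed.

Lemma pair_inj a b c d : ⟨a, b⟩ = ⟨c, d⟩ -> a = c /\ b = d.
Proof. intro H. apply to_nat_inj in H. now injection H. Qed.

(** * Closure properties of relative computability *)

Section Closure.
Variable O : oracle.

Lemma computes_ext f g :
  (forall x, f x = g x) -> computes O f -> computes O g.
Proof. intros E [e He]. exists e. intro x. now rewrite <- E. Qed.

Lemma computes_id : computes O (fun x => x).
Proof. exists ⟨2, 0⟩. intro x. eapply ev_id, cancel_of_to. Qed.

Lemma computes_comp f g :
  computes O f -> computes O g -> computes O (fun x => f (g x)).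
Proof.
  intros [e He] [d Hd]. exists ⟨6, ⟨e, d⟩⟩. intro x.
  eapply ev_comp; try apply cancel_of_to; eauto.
Qed.

Lemma computes_succ f : computes O f -> computes O (fun x => S (f x)).
Proof.
  apply (computes_comp S). exists ⟨1, 0⟩. intro x. eapply ev_succ, cancel_of_to.
Qed.

Lemma computes_pr1 f : computes O f -> computes O (fun x => pr1 (f x)).
Proof.
  apply (computes_comp (fun x => pr1 x)).
  exists ⟨3, 0⟩. intro x. eapply ev_fst, cancel_of_to.
Qed.

Lemma computes_pr2 f : computes O f -> computes O (fun x => pr2 (f x)).
Proof.
  apply (computes_comp (fun x => pr2 x)).
  exists ⟨4, 0⟩. intro x. eapply ev_snd, cancel_of_to.
Qed.

Lemma computes_const c : computes O (fun _ => c).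
Proof.
  induction c as [|c IH]; [|now apply computes_succ].
  exists ⟨0, 0⟩. intro x. eapply ev_zero, cancel_of_to.
Qed.

Lemma computes_pair f g :
  computes O f -> computes O g -> computes O (fun x => ⟨f x, g x⟩).
Proof.
  intros [e He] [d Hd]. exists ⟨5, ⟨e, d⟩⟩. intro x.
  eapply ev_pair; try apply cancel_of_to; eauto.
Qed.

Lemma eval_primrec a g (H : nat -> nat -> nat) :
  (forall x, eval O a x (H x 0)) ->
  (forall x n, eval O g ⟨x, ⟨n, H x n⟩⟩ (H x (S n))) ->
  forall x n, eval O ⟨7, ⟨a, g⟩⟩ ⟨x, n⟩ (H x n).
Proof.
  intros H0 HS x n. induction n as [|n IH].
  - eapply ev_rec0; try apply cancel_of_to. apply H0.
  - eapply ev_recS; try apply cancel_of_to; eauto.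
Qed.

(** The program [g] need only be right on the values that [H] really takes. This matters for the
    greedy history, where one step is a search that may diverge on an arbitrary code. *)
Lemma computes_iter_along (H : nat -> nat -> nat) g :
  computes O (fun x => H x 0) ->
  (forall x n, eval O g ⟨x, ⟨n, H x n⟩⟩ (H x (S n))) ->
  computes O (fun z => H (pr1 z) (pr2 z)).
Proof.
  intros [a Ha] Hg. exists ⟨7, ⟨a, g⟩⟩. intro z. rewrite <- (pair_pr z) at 1.
  now apply eval_primrec.
Qed.

Lemma computes_app2 (h : nat -> nat -> nat) f g :
  computes O (fun z => h (pr1 z) (pr2 z)) -> computes O f -> computes O g ->
  computes O (fun x => h (f x) (g x)).
Proof.
  intros Hh Hf Hg.
  apply (computes_ext (fun x => (fun z => h (pr1 z) (pr2 z)) ⟨f x, g x⟩)).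
  - intro x. now rewrite pr1_pair, pr2_pair.
  - apply (computes_comp (fun z => h (pr1 z) (pr2 z))); auto using computes_pair.
Qed.

Lemma computes_rec a (b : nat -> nat -> nat -> nat) n :
  computes O a ->
  computes O (fun z => b (pr1 z) (pr1 (pr2 z)) (pr2 (pr2 z))) ->
  computes O n ->
  computes O (fun x => nat_rect (fun _ => nat) (a x) (b x) (n x)).
Proof.
  intros Ha [g Hg] Hn.
  apply (computes_app2 (fun x n => nat_rect (fun _ => nat) (a x) (b x) n) (fun x => x));
    auto using computes_id.
  apply (computes_iter_along (fun x n => nat_rect (fun _ => nat) (a x) (b x) n) g);
    [exact Ha|]. intros x i.
  specialize (Hg ⟨x, ⟨i, nat_rect (fun _ => nat) (a x) (b x) i⟩⟩).
  now rewrite ?pr1_pair, ?pr2_pair, ?pr1_pair, ?pr2_pair in Hg.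
Qed.

Lemma computes_iter a (b : nat -> nat -> nat) n :
  computes O a -> computes O (fun z => b (pr1 z) (pr2 z)) -> computes O n ->
  computes O (fun x => Nat.iter (n x) (b x) (a x)).
Proof.
  intros Ha Hb Hn. apply (computes_rec a (fun x _ r => b x r) n); auto.
  apply (computes_app2 b (fun z => pr1 z) (fun z => pr2 (pr2 z)));
    auto using computes_pr1, computes_pr2, computes_id.
Qed.

Lemma computes_add f g :
  computes O f -> computes O g -> computes O (fun x => f x + g x).
Proof.
  intros Hf Hg.
  apply (computes_ext (fun x => Nat.iter (g x) ((fun _ r => S r) x) (f x))).
  - intro x. induction (g x) as [|n IH]; simpl; lia.
  - apply computes_iter; auto using computes_succ, computes_pr2, computes_id.
Qed.

Lemma computes_pred f : computes O f -> computes O (fun x => pred (f x)).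
Proof.
  intros Hf.
  apply (computes_ext (fun x => nat_rect (fun _ => nat) 0 ((fun _ i _ => i) x) (f x))).
  - intro x. now destruct (f x).
  - apply (computes_rec (fun _ => 0) (fun _ i _ => i));
      auto using computes_const, computes_pr1, computes_pr2, computes_id.
Qed.

Lemma computes_sub f g :
  computes O f -> computes O g -> computes O (fun x => f x - g x).
Proof.
  intros Hf Hg.
  apply (computes_ext (fun x => Nat.iter (g x) ((fun _ r => pred r) x) (f x))).
  - intro x. induction (g x) as [|n IH]; simpl; lia.
  - apply computes_iter; auto using computes_pred, computes_pr2, computes_id.
Qed.

Lemma computes_mul f g :
  computes O f -> computes O g -> computes O (fun x => f x * g x).
Proof.
  intros Hf Hg.
  apply (computes_ext (fun x => Nat.iter (g x) ((fun x r => r + f x) x) 0)).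
  - intro x. induction (g x) as [|n IH]; simpl; lia.
  - apply (computes_iter _ (fun x r => r + f x)); auto using computes_const.
    apply computes_add; [|apply (computes_comp f)];
      auto using computes_pr1, computes_pr2, computes_id.
Qed.

Lemma T_red_of_computes P f :
  computes O f -> (forall x, P x -> f x = 1) -> (forall x, ~ P x -> f x = 0) ->
  T_red P O.
Proof.
  intros [e He] H1 H0. exists e. intro x. split; intro H.
  - rewrite <- (H1 x H). apply He.
  - rewrite <- (H0 x H). apply He.
Qed.

Lemma T_red_computes P :
  T_red P O -> computes O (fun x => if dec (P x) then 1 else 0).
Proof.
  intros [e He]. exists e. intro x. destruct (dec (P x)); now apply He.
Qed.

Lemma T_red_ext P P' : (forall x, P x <-> P' x) -> T_red P O -> T_red P' O.
Proof.
  intros E [e He]. exists e. intro x. rewrite <- E. apply He.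
Qed.

Lemma T_red_eq0 f : computes O f -> T_red (fun x => f x = 0) O.
Proof.
  intros Hf. eapply T_red_of_computes.
  - apply (computes_sub _ _ (computes_const 1) Hf).
  - intros x H. cbv beta. lia.
  - intros x H. cbv beta. lia.
Qed.

Lemma T_red_le f g : computes O f -> computes O g -> T_red (fun x => f x <= g x) O.
Proof.
  intros Hf Hg. apply (T_red_ext (fun x => f x - g x = 0)); [intro x; lia|].
  now apply T_red_eq0, computes_sub.
Qed.

Lemma T_red_lt f g : computes O f -> computes O g -> T_red (fun x => f x < g x) O.
Proof. intros Hf Hg. apply T_red_le; auto using computes_succ. Qed.

Lemma T_red_eq f g : computes O f -> computes O g -> T_red (fun x => f x = g x) O.
Proof.
  intros Hf Hg. apply (T_red_ext (fun x => (f x - g x) + (g x - f x) = 0)); [intro x; lia|].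
  apply T_red_eq0, computes_add; now apply computes_sub.
Qed.

(** Nonuniform: the classical truth value of [P] is wired into the program. *)
Lemma T_red_const (P : Prop) : T_red (fun _ => P) O.
Proof.
  destruct (classic P).
  - apply (T_red_of_computes _ _ (computes_const 1)); tauto.
  - apply (T_red_of_computes _ _ (computes_const 0)); tauto.
Qed.

Lemma T_red_not P : T_red P O -> T_red (fun x => ~ P x) O.
Proof.
  intros HP. apply T_red_computes in HP.
  eapply T_red_of_computes; [apply (computes_sub _ _ (computes_const 1) HP)| |];
    intros x H; simpl; destruct (dec (P x)); tauto.
Qed.

Lemma T_red_and P Q : T_red P O -> T_red Q O -> T_red (fun x => P x /\ Q x) O.
Proof.
  intros HP HQ. apply T_red_computes in HP, HQ.
  eapply T_red_of_computes; [apply (computes_mul _ _ HP HQ)| |];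
    intros x H; simpl; destruct (dec (P x)), (dec (Q x)); simpl; tauto.
Qed.

Lemma T_red_imp P Q : T_red P O -> T_red Q O -> T_red (fun x => P x -> Q x) O.
Proof.
  intros HP HQ. apply (T_red_ext (fun x => ~ (P x /\ ~ Q x))).
  - intro x. destruct (classic (Q x)); tauto.
  - apply T_red_not, T_red_and; auto using T_red_not.
Qed.

Lemma T_red_or P Q : T_red P O -> T_red Q O -> T_red (fun x => P x \/ Q x) O.
Proof.
  intros HP HQ. apply (T_red_ext (fun x => ~ P x -> Q x)).
  - intro x. destruct (classic (P x)); tauto.
  - apply T_red_imp; auto using T_red_not.
Qed.

Lemma T_red_iff P Q : T_red P O -> T_red Q O -> T_red (fun x => P x <-> Q x) O.
Proof. intros HP HQ. apply T_red_and; now apply T_red_imp. Qed.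

Lemma T_red_comp P f : T_red P O -> computes O f -> T_red (fun x => P (f x)) O.
Proof.
  intros HP Hf. apply T_red_computes in HP.
  eapply T_red_of_computes; [exact (computes_comp _ _ HP Hf)| |];
    intros x H; simpl; destruct (dec (P (f x))); tauto.
Qed.

Lemma T_red_app2 (P : nat -> nat -> Prop) f g :
  T_red (fun z => P (pr1 z) (pr2 z)) O -> computes O f -> computes O g ->
  T_red (fun x => P (f x) (g x)) O.
Proof.
  intros HP Hf Hg.
  apply (T_red_ext (fun x => (fun z => P (pr1 z) (pr2 z)) ⟨f x, g x⟩)).
  - intro x. now rewrite pr1_pair, pr2_pair.
  - apply (T_red_comp (fun z => P (pr1 z) (pr2 z))); auto using computes_pair.
Qed.

Lemma T_red_app3 (P : nat -> nat -> nat -> Prop) f g h :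
  T_red (fun z => P (pr1 z) (pr1 (pr2 z)) (pr2 (pr2 z))) O ->
  computes O f -> computes O g -> computes O h ->
  T_red (fun x => P (f x) (g x) (h x)) O.
Proof.
  intros HP Hf Hg Hh.
  apply (T_red_ext (fun x => (fun z => P (pr1 z) (pr1 (pr2 z)) (pr2 (pr2 z)))
    ⟨f x, ⟨g x, h x⟩⟩)).
  - intro x. now rewrite ?pr1_pair, ?pr2_pair, ?pr1_pair, ?pr2_pair.
  - apply (T_red_comp (fun z => P (pr1 z) (pr1 (pr2 z)) (pr2 (pr2 z))));
      auto using computes_pair.
Qed.

Lemma computes_if P f g :
  T_red P O -> computes O f -> computes O g ->
  computes O (fun x => if dec (P x) then f x else g x).
Proof.
  intros HP Hf Hg. apply T_red_computes in HP.
  eapply computes_ext; [|exact (computes_add _ _ (computes_mul _ _ HP Hf)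
    (computes_mul _ _ (computes_sub _ _ (computes_const 1) HP) Hg))].
  intro x. simpl. destruct (dec (P x)); simpl; lia.
Qed.

Lemma T_red_ball (P : nat -> nat -> Prop) n :
  T_red (fun z => P (pr1 z) (pr2 z)) O -> computes O n ->
  T_red (fun x => forall i, i < n x -> P x i) O.
Proof.
  intros HP Hn.
  pose (r := fun x n => nat_rect (fun _ => nat) 1 (fun i r => if dec (P x i) then r else 0) n).
  assert (r1 : forall x n, (forall i, i < n -> P x i) -> r x n = 1).
  { intros x k. induction k as [|k IH]; intro H; simpl; [reflexivity|].
    destruct (dec (P x k)) as [|N]; [apply IH; auto|]. destruct N. apply H. lia. }
  assert (r0 : forall x n, ~ (forall i, i < n -> P x i) -> r x n = 0).
  { intros x k. induction k as [|k IH]; intro H; simpl; [destruct H; lia|].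
    destruct (dec (P x k)) as [y|]; [|reflexivity]. apply IH. intro H'. apply H.
    intros i Hi. destruct (Nat.eq_dec i k) as [->|]; [exact y|]. apply H'. lia. }
  apply (T_red_of_computes _ (fun x => r x (n x))); auto.
  apply (computes_rec (fun _ => 1) (fun x i r => if dec (P x i) then r else 0));
    auto using computes_const.
  apply computes_if.
  - apply T_red_app2; auto using computes_id, computes_pr1, computes_pr2.
  - auto using computes_id, computes_pr1, computes_pr2.
  - apply computes_const.
Qed.

Lemma T_red_bex (P : nat -> nat -> Prop) n :
  T_red (fun z => P (pr1 z) (pr2 z)) O -> computes O n ->
  T_red (fun x => exists i, i < n x /\ P x i) O.
Proof.
  intros HP Hn. apply (T_red_ext (fun x => ~ (forall i, i < n x -> ~ P x i))).
  - intro x. split.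
    + intro H. apply NNPP. intro N. apply H. intros i Hi Hp. apply N. eauto.
    + intros (i & Hi & Hp) H. now apply (H i).
  - apply T_red_not, (T_red_ball (fun x i => ~ P x i)); auto.
    now apply T_red_not.
Qed.

(** The tested program [f] is exposed along with the search program [e], because [T_red_jump] must
    also argue that [e] halts only if there is a witness. Minimisation looks for a zero, hence the
    negated characteristic function. *)
Lemma eval_search (P : nat -> Prop) :
  T_red P O -> exists e f,
    e = ⟨8, f⟩ /\
    (forall x, (P x -> eval O f x 0) /\ (~ P x -> eval O f x 1)) /\
    forall x n, P ⟨x, n⟩ -> (forall m, m < n -> ~ P ⟨x, m⟩) -> eval O e x n.
Proof.
  intros HP. apply T_red_not in HP. destruct HP as [f Hf].
  assert (Hf' : forall x, (P x -> eval O f x 0) /\ (~ P x -> eval O f x 1)).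
  { intro x. destruct (Hf x) as [H1 H2]. split; auto. }
  exists ⟨8, f⟩, f. repeat split; try apply Hf'. intros x n Hn Hm.
  eapply ev_min; [apply cancel_of_to|now apply Hf'|].
  intros m Hlt. exists 0. now apply Hf', Hm.
Qed.

Lemma least_nat (P : nat -> Prop) :
  (exists n, P n) -> exists n, P n /\ forall m, m < n -> ~ P m.
Proof.
  intros [n Hn]. induction n as [n IH] using lt_wf_ind.
  destruct (classic (exists m, m < n /\ P m)) as [(m & Hm & HP)|N]; [eauto|].
  exists n. split; [exact Hn|]. intros m Hm HP. apply N. eauto.
Qed.

Lemma computes_search (P : nat -> nat -> Prop) :
  T_red (fun z => P (pr1 z) (pr2 z)) O -> (forall x, exists n, P x n) ->
  exists f, computes O f /\ forall x, P x (f x).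
Proof.
  intros HP Hex. destruct (eval_search _ HP) as (e & _ & _ & _ & He).
  assert (L : forall x, exists n, P x n /\ forall m, m < n -> ~ P x m)
    by (intro x; apply least_nat, Hex).
  exists (fun x => proj1_sig (constructive_indefinite_description _ (L x))).
  split.
  - exists e. intro x.
    destruct (constructive_indefinite_description _ (L x)) as (n & Hn & Hm); simpl.
    apply He; [|intros m Hlt]; rewrite pr1_pair, pr2_pair; auto.
  - intro x. now destruct (constructive_indefinite_description _ (L x)) as (n & Hn & Hm).
Qed.

End Closure.

(** The shape of the goal selects a closure property. The generic application patterns are the last
    resort for their kind of goal and expect the computability of the head symbol among the
    hypotheses. *)
Ltac comp_core :=
  match goal with
  | |- computes _ (fun _ => ?c) => apply computes_const
  | |- computes _ (fun x => x) => apply computes_id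
  | |- computes _ (fun x => S (@?f x)) => apply computes_succ
  | |- computes _ (fun x => pred (@?f x)) => apply computes_pred
  | |- computes _ (fun x => pr1 (@?f x)) => apply computes_pr1
  | |- computes _ (fun x => pr2 (@?f x)) => apply computes_pr2
  | |- computes _ (fun x => to_nat (@?f x, @?g x)) => apply (computes_pair _ f g)
  | |- computes _ (fun x => @?f x + @?g x) => apply (computes_add _ f g)
  | |- computes _ (fun x => @?f x - @?g x) => apply (computes_sub _ f g)
  | |- computes _ (fun x => @?f x * @?g x) => apply (computes_mul _ f g)
  | |- computes _ (fun x => if dec (@?P x) then @?f x else @?g x) =>
      apply (computes_if _ P f g)
  | |- computes _ (fun x => Nat.iter (@?n x) (fun r => @?b x r) (@?a x)) =>
      apply (computes_iter _ a b n)
  | |- computes _ (fun x => ?h (@?f x)) =>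
      apply (computes_comp _ h f); [solve [auto]|]
  | |- computes _ (fun x => ?h (@?f x) (@?g x)) =>
      apply (computes_app2 _ h f g); [solve [auto]| |]
  | |- T_red (fun _ => ?P) _ => apply T_red_const
  | |- T_red (fun x => forall i, i < @?n x -> @?P x i) _ => apply (T_red_ball _ P n)
  | |- T_red (fun x => exists i, i < @?n x /\ @?P x i) _ => apply (T_red_bex _ P n)
  | |- T_red (fun x => @?P x /\ @?Q x) _ => apply (T_red_and _ P Q)
  | |- T_red (fun x => @?P x \/ @?Q x) _ => apply (T_red_or _ P Q)
  | |- T_red (fun x => @?P x <-> @?Q x) _ => apply (T_red_iff _ P Q)
  | |- T_red (fun x => ~ @?P x) _ => apply (T_red_not _ P)
  | |- T_red (fun x => @?P x -> @?Q x) _ => apply (T_red_imp _ P Q)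
  | |- T_red (fun x => @?f x = @?g x) _ => apply (T_red_eq _ f g)
  | |- T_red (fun x => @?f x <= @?g x) _ => apply (T_red_le _ f g)
  | |- T_red (fun x => @?f x < @?g x) _ => apply (T_red_lt _ f g)
  | |- T_red (fun x => ?P (@?f x)) _ =>
      apply (T_red_comp _ P f); [solve [auto]|]
  | |- T_red (fun x => ?P (@?f x) (@?g x)) _ =>
      apply (T_red_app2 _ P f g); [solve [auto]| |]
  end.

Ltac comp := repeat first [assumption | comp_core; cbv beta].

(** * Oracle substitution *)

(** An inversion principle by tag. Apart from primitive recursion, which calls [e] itself on a
    smaller argument, only programs with smaller codes are called, so strong induction on [e] can
    replace induction on derivations. *)
Definition eval_clause (O : oracle) e x y : Prop :=
  let p := pr2 e in
  match pr1 e with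
  | 0 => y = 0
  | 1 => y = S x
  | 2 => y = x
  | 3 => y = pr1 x
  | 4 => y = pr2 x
  | 5 => exists u v, eval O (pr1 p) x u /\ eval O (pr2 p) x v /\ y = ⟨u, v⟩
  | 6 => exists u, eval O (pr2 p) x u /\ eval O (pr1 p) u y
  | 7 => match pr2 x with
         | 0 => eval O (pr1 p) (pr1 x) y
         | S n => exists z, eval O e ⟨pr1 x, n⟩ z /\ eval O (pr2 p) ⟨pr1 x, ⟨n, z⟩⟩ y
         end
  | 8 => eval O p ⟨x, y⟩ 0 /\ forall m, m < y -> exists k, eval O p ⟨x, m⟩ (S k)
  | 9 => O x y
  | _ => False
  end.

Lemma eval_iff O e x y : eval O e x y <-> eval_clause O e x y.
Proof.
  unfold eval_clause. split.
  - intros []; repeat (match goal with H : of_nat ?a = _ |- context [of_nat ?a] =>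
      rewrite H end; cbn); rewrite ?pr1_pair, ?pr2_pair; eauto 7.
  - destruct (of_nat e) as [t p] eqn:Et; cbn.
    pose proof (surjective_pairing (of_nat p)) as Ep.
    do 10 (try destruct t as [|t]); intro H; try subst y.
    + eapply ev_zero; eauto.
    + eapply ev_succ; eauto.
    + eapply ev_id; eauto.
    + eapply ev_fst; eauto.
    + eapply ev_snd; eauto.
    + destruct H as (u & v & Hu & Hv & ->). eapply ev_pair; eauto.
    + destruct H as (u & Hu & Hv). eapply ev_comp; eauto.
    + rewrite <- (pair_pr x). destruct (pr2 x) as [|n].
      * eapply ev_rec0; eauto.
      * destruct H as (z & Hz & Hy). eapply ev_recS; eauto.
    + eapply ev_min; eauto; apply H.
    + eapply ev_oracle; eauto.
    + destruct H.
Qed.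

Lemma pr2_lt e : 0 < pr1 e -> pr2 e < e.
Proof.
  intro H. pose proof (to_nat_non_decreasing (pr1 e) (pr2 e)).
  rewrite (pair_pr e) in *. lia.
Qed.

Lemma pr_le e : pr1 e <= e /\ pr2 e <= e.
Proof.
  pose proof (to_nat_non_decreasing (pr1 e) (pr2 e)). rewrite (pair_pr e) in *. lia.
Qed.

(** Each oracle query inside [e] is replaced by the program [d]. One direction suffices, since every
    clause, including minimisation, uses [eval] only positively. *)
Lemma eval_oracle_subst (O O' : oracle) d :
  (forall x y, O x y -> eval O' d x y) ->
  forall e, exists e', forall x y, eval O e x y -> eval O' e' x y.
Proof.
  intros Hd e. induction e as [e IH] using lt_wf_ind.
  pose proof (pr2_lt e) as Hp. pose proof (pr_le (pr2 e)) as [Hf Hg].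
  assert (E : forall x y, eval O e x y -> eval_clause O e x y) by (intros; now apply eval_iff).
  unfold eval_clause in E. remember (pr1 e) as t eqn:Et.
  pose proof (pair_pr e) as Ee. rewrite <- Et in Ee.
  destruct t as [|t].
  { exists e. intros x y H. apply E in H. apply eval_iff. unfold eval_clause. now rewrite <- Et. }
  destruct (IH (pr2 e)) as [p' Ip]; [lia|].
  destruct (IH (pr1 (pr2 e))) as [f' If]; [lia|].
  destruct (IH (pr2 (pr2 e))) as [g' Ig]; [lia|].
  do 9 (try destruct t as [|t]).
  1-4: exists e; intros x y H; apply E in H; apply eval_iff; unfold eval_clause;
    now rewrite <- Et.
  - exists ⟨5, ⟨f', g'⟩⟩. intros x y H. apply E in H.
    destruct H as (u & v & Hu & Hv & ->). apply eval_iff. unfold eval_clause.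
    rewrite ?pr1_pair, ?pr2_pair, ?pr1_pair, ?pr2_pair. eauto 7.
  - exists ⟨6, ⟨f', g'⟩⟩. intros x y H. apply E in H.
    destruct H as (u & Hu & Hv). apply eval_iff. unfold eval_clause.
    rewrite ?pr1_pair, ?pr2_pair, ?pr1_pair, ?pr2_pair. eauto 7.
  (* Primitive recursion calls the program itself, so the induction on codes is supplemented by one
     on the recursion argument. *)
  - exists ⟨7, ⟨f', g'⟩⟩. intros x. rewrite <- (pair_pr x).
    generalize (pr1 x) as a, (pr2 x) as n. intros a n. induction n as [|n IHn]; intros y H;
      apply E in H; rewrite ?pr1_pair, ?pr2_pair in H; apply eval_iff; unfold eval_clause;
      rewrite ?pr1_pair, ?pr2_pair, ?pr1_pair, ?pr2_pair; [now apply If|].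
    destruct H as (z & Hz & Hy). eauto.
  - exists ⟨8, p'⟩. intros x y H. apply E in H. apply eval_iff. unfold eval_clause.
    rewrite ?pr1_pair, ?pr2_pair. destruct H as [H0 H]. split; [now apply Ip|].
    intros m Hm. destruct (H m Hm) as [k Hk]. eauto.
  - exists d. intros x y H. apply E in H. now apply Hd.
  - exists 0. intros x y H. now apply E in H.
Qed.

Lemma T_red_subst O O' d P :
  (forall x y, O x y -> eval O' d x y) -> T_red P O -> T_red P O'.
Proof.
  intros Hd [e He]. destruct (eval_oracle_subst _ _ _ Hd e) as [e' He'].
  exists e'. intro x. split; intro H; apply He', He, H.
Qed.

Lemma set_oracle_chi X x : set_oracle X x (if dec (X x) then 1 else 0).
Proof. unfold set_oracle. destruct (dec (X x)); tauto. Qed.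

Lemma set_oracle_fun X x y : set_oracle X x y -> (if dec (X x) then 1 else 0) = y.
Proof. intros [[H ->]|[H ->]]; destruct (dec (X x)); tauto. Qed.

(** The empty oracle always answers 0, so a constant program simulates it. *)
Lemma computable_T_red P O : computable_set P -> T_red P O.
Proof.
  destruct (computes_const O 0) as [d Hd]. apply (T_red_subst _ _ d).
  intros x y [[[] _]|[_ ->]]. apply Hd.
Qed.

Lemma T_red_self X : T_red X (set_oracle X).
Proof.
  exists ⟨9, 0⟩. intro x.
  split; intro H; (eapply ev_oracle; [apply cancel_of_to|]); unfold set_oracle; tauto.
Qed.

Lemma join_oracle_even f g x : join_oracle f g (2 * x) (f x).
Proof.
  left. rewrite Nat.mul_comm, Nat.Div0.mod_mul, Nat.div_mul; auto.
Qed.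

Lemma join_oracle_odd f g x : join_oracle f g (S (2 * x)) (g x).
Proof.
  right. replace (S (2 * x)) with (1 + x * 2) by lia.
  rewrite Nat.Div0.mod_add, Nat.div_add; auto.
Qed.

Lemma computes_join_left f g : computes (join_oracle f g) f.
Proof.
  destruct (computes_mul (join_oracle f g) _ _ (computes_const _ 2) (computes_id _)) as [e He].
  exists ⟨6, ⟨⟨9, 0⟩, e⟩⟩. intro x.
  eapply ev_comp; try apply cancel_of_to; [apply He|].
  eapply ev_oracle; [apply cancel_of_to|]. apply join_oracle_even.
Qed.

Lemma computes_join_right f g : computes (join_oracle f g) g.
Proof.
  destruct (computes_succ _ _
    (computes_mul (join_oracle f g) _ _ (computes_const _ 2) (computes_id _))) as [e He].
  exists ⟨6, ⟨⟨9, 0⟩, e⟩⟩. intro x.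
  eapply ev_comp; try apply cancel_of_to; [apply He|].
  eapply ev_oracle; [apply cancel_of_to|]. apply join_oracle_odd.
Qed.

(** A query to the join is answered by halving it and calling [f] or [g]; the half is found by
    search. This is how a lower bound on all pairs of embeddings becomes a lower bound on oracles
    that compute such a pair. *)
Lemma T_red_join_trans P f g O :
  computes O f -> computes O g -> T_red P (join_oracle f g) -> T_red P O.
Proof.
  intros Hf Hg.
  assert (Hh : exists h, computes O h /\ forall n, n = 2 * h n \/ n = S (2 * h n)).
  { apply (computes_search O (fun n h => n = 2 * h \/ n = S (2 * h))); [comp|].
    intro n. destruct (Nat.Even_or_Odd n) as [[k ->]|[k ->]]; exists k; lia. }
  destruct Hh as (h & Ch & Hh).
  assert (Cj : computes O (fun n => if dec (n = 2 * h n) then f (h n) else g (h n))).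
  { comp; auto. }
  destruct Cj as [d Hd]. apply (T_red_subst _ _ d). intros x y H.
  specialize (Hd x). cbv beta in Hd. destruct (Hh x) as [E|E].
  - destruct (dec (x = 2 * h x)) as [_|N]; [|tauto]. rewrite E in H.
    destruct H as [[_ <-]|[M _]].
    + rewrite Nat.mul_comm, Nat.div_mul; auto.
    + rewrite Nat.mul_comm, Nat.Div0.mod_mul in M. discriminate.
  - destruct (dec (x = 2 * h x)) as [N|_]; [lia|]. rewrite E in H.
    replace (S (2 * h x)) with (1 + h x * 2) in H by lia. destruct H as [[M _]|[_ <-]].
    + rewrite Nat.Div0.mod_add in M. discriminate.
    + rewrite Nat.div_add; auto.
Qed.

(** * An abstract machine and normal forms for the jump *)

(* A machine state is [⟨0, ⟨⟨e, x⟩, K⟩⟩] (run program [e] on [x]) or [⟨1, ⟨y, K⟩⟩]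
   (hand [y] to the top frame of [K]); the stack [K] is [0] when empty and
   otherwise [S ⟨frame, rest⟩]. *)
Definition ev e x K := ⟨0, ⟨⟨e, x⟩, K⟩⟩.
Definition ret y K := ⟨1, ⟨y, K⟩⟩.
Definition push t d K := S ⟨⟨t, d⟩, K⟩.

(** [z] is the whole state. It is returned unchanged on an invalid tag, so the machine then loops
    and never reaches a final state. *)
Definition step_ev (o : nat -> nat) z e x K :=
  let t := pr1 e in let p := pr2 e in
  if dec (t = 0) then ret 0 K else
  if dec (t = 1) then ret (S x) K else
  if dec (t = 2) then ret x K else
  if dec (t = 3) then ret (pr1 x) K else
  if dec (t = 4) then ret (pr2 x) K else
  if dec (t = 5) then ev (pr1 p) x (push 0 ⟨pr2 p, x⟩ K) else
  if dec (t = 6) then ev (pr2 p) x (push 1 (pr1 p) K) else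
  if dec (t = 7) then
    if dec (pr2 x = 0) then ev (pr1 p) (pr1 x) K
    else ev e ⟨pr1 x, pred (pr2 x)⟩ (push 2 ⟨pr2 p, ⟨pr1 x, pred (pr2 x)⟩⟩ K) else
  if dec (t = 8) then ev p ⟨x, 0⟩ (push 3 ⟨p, ⟨x, 0⟩⟩ K) else
  if dec (t = 9) then ret (o x) K else z.

(** Frames 0 and 4 wait for the first and second component of a pair, 1 for the inner value of a
    composition, 2 for the previous value of a primitive recursion, 3 for a test of a
    minimisation. *)
Definition step_ret t d y K :=
  if dec (t = 0) then ev (pr1 d) (pr2 d) (push 4 y K) else
  if dec (t = 1) then ev d y K else
  if dec (t = 2) then ev (pr1 d) ⟨pr1 (pr2 d), ⟨pr2 (pr2 d), y⟩⟩ K else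
  if dec (t = 3) then
    if dec (y = 0) then ret (pr2 (pr2 d)) K
    else ev (pr1 d) ⟨pr1 (pr2 d), S (pr2 (pr2 d))⟩
           (push 3 ⟨pr1 d, ⟨pr1 (pr2 d), S (pr2 (pr2 d))⟩⟩ K) else
  ret ⟨d, y⟩ K.

Definition step (o : nat -> nat) z :=
  let a := pr1 (pr2 z) in let K := pr2 (pr2 z) in
  if dec (pr1 z = 0) then step_ev o z (pr1 a) (pr2 a) K else
  if dec (K = 0) then z else
  step_ret (pr1 (pr1 (pred K))) (pr2 (pr1 (pred K))) a (pr2 (pred K)).

Definition final z := pr1 z <> 0 /\ pr2 (pr2 z) = 0.

Definition run o s z := Nat.iter s (step o) z.
Definition halts o s n := final (run o s (ev (pr1 n) (pr2 n) 0)).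

Lemma step_ev_eq o e x K : step o (ev e x K) = step_ev o (ev e x K) e x K.
Proof.
  assert (H : pr1 (ev e x K) = 0 /\ pr2 (ev e x K) = ⟨⟨e, x⟩, K⟩)
    by (unfold ev; now rewrite pr1_pair, pr2_pair).
  unfold step. destruct H as [-> ->]. rewrite ?pr1_pair, ?pr2_pair, ?pr1_pair, ?pr2_pair.
  destruct (dec (0 = 0)); [reflexivity|tauto].
Qed.

Lemma step_ret_eq o y t d K : step o (ret y (push t d K)) = step_ret t d y K.
Proof.
  assert (H : pr1 (ret y (push t d K)) = 1 /\ pr2 (ret y (push t d K)) = ⟨y, push t d K⟩)
    by (unfold ret; now rewrite pr1_pair, pr2_pair).
  unfold step. destruct H as [-> ->]. rewrite ?pr1_pair, ?pr2_pair. unfold push.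
  destruct (dec (1 = 0)); [discriminate|]. destruct (dec (S _ = 0)); [discriminate|].
  simpl pred. now rewrite ?pr1_pair, ?pr2_pair, ?pr1_pair, ?pr2_pair.
Qed.

Lemma run_S o s z : run o (S s) z = run o s (step o z).
Proof. apply Nat.iter_succ_r. Qed.

Lemma run_add o s s' z : run o (s + s') z = run o s (run o s' z).
Proof. apply Nat.iter_add. Qed.

Lemma run_final o s z : final z -> run o s z = z.
Proof.
  intros [H1 H2]. induction s as [|s IH]; [reflexivity|].
  rewrite run_S. unfold step.
  destruct (dec (pr1 z = 0)); [tauto|]. now destruct (dec (pr2 (pr2 z) = 0)).
Qed.

Lemma final_le o s s' z : s <= s' -> final (run o s z) -> final (run o s' z).
Proof.
  intros Hs H. replace s' with (s' - s + s) by lia.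
  rewrite run_add, run_final; auto.
Qed.

Lemma ev_not_final e x K : ~ final (ev e x K).
Proof. unfold final, ev. rewrite pr1_pair. tauto. Qed.

Lemma ret_final y : final (ret y 0).
Proof. unfold final, ret. rewrite ?pr1_pair, ?pr2_pair, ?pr2_pair. auto. Qed.

Ltac decs := repeat match goal with |- context [dec ?P] =>
  destruct (dec P); try discriminate; try congruence end.

Lemma run_trans o z w v :
  (exists s, run o s z = w) -> (exists s, run o s w = v) -> exists s, run o s z = v.
Proof. intros [s <-] [s' <-]. exists (s' + s). apply run_add. Qed.

Lemma run_step o z w v : step o z = w -> (exists s, run o s w = v) -> exists s, run o s z = v.
Proof. intros <- [s <-]. exists (S s). apply run_S. Qed.

Ltac tag := unfold step_ev, step_ret;
  repeat match goal with H : pr1 _ = _ |- _ => rewrite H end;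
  rewrite ?pr1_pair, ?pr2_pair, ?pr1_pair, ?pr2_pair; decs.
Ltac step_machine := eapply run_step;
  [first [rewrite step_ev_eq | rewrite step_ret_eq]; tag; reflexivity|].

(** The arbitrary stack [K] lets the runs of subprograms be chained. *)
Lemma eval_run (O : oracle) o e x y K :
  (forall x y, O x y -> o x = y) -> eval O e x y ->
  exists s, run o s (ev e x K) = ret y K.
Proof.
  intros Ho. revert x y K. induction e as [e IH] using lt_wf_ind. intros x y K H.
  pose proof (pr2_lt e) as Hp. pose proof (pr_le (pr2 e)) as [Hf Hg].
  apply eval_iff in H. unfold eval_clause in H.
  assert (R : forall z, exists s, run o s z = z) by (intro z; now exists 0).
  destruct (pr1 e) as [|t] eqn:Et; [subst y; step_machine; apply R|].
  do 9 (try destruct t as [|t]).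
  - subst y. step_machine. apply R.
  - subst y. step_machine. apply R.
  - subst y. step_machine. apply R.
  - subst y. step_machine. apply R.
  - destruct H as (u & v & Hu & Hv & ->). step_machine.
    eapply run_trans; [apply IH; [lia|exact Hu]|]. step_machine.
    eapply run_trans; [apply IH; [lia|exact Hv]|]. step_machine. apply R.
  - destruct H as (u & Hu & Hv). step_machine.
    eapply run_trans; [apply IH; [lia|exact Hu]|]. step_machine.
    apply IH; [lia|exact Hv].
  - revert K y H. rewrite <- (pair_pr x). generalize (pr1 x) as a, (pr2 x) as n.
    intros a n. rewrite ?pr1_pair, ?pr2_pair. induction n as [|n IHn]; intros K y H.
    + step_machine. apply IH; [lia|exact H].
    + destruct H as (z & Hz & Hy). step_machine.
      apply eval_iff in Hz. unfold eval_clause in Hz.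
      rewrite Et, ?pr1_pair, ?pr2_pair in Hz.
      eapply run_trans; [apply IHn, Hz|]. step_machine. apply IH; [lia|exact Hy].
  - destruct H as [H0 H]. step_machine.
    (* The minimisation loop, by induction on the distance [n] from the current candidate [i] to the
       result [y]. *)
    assert (L : forall n i, i + n = y ->
      exists s, run o s (ev (pr2 e) ⟨x, i⟩ (push 3 ⟨pr2 e, ⟨x, i⟩⟩ K)) = ret y K).
    { induction n as [|n IHn]; intros i Hi.
      - replace i with y by lia.
        eapply run_trans; [apply IH; [lia|exact H0]|]. step_machine. apply R.
      - destruct (H i) as [k Hk]; [lia|].
        eapply run_trans; [apply IH; [lia|exact Hk]|]. step_machine. apply IHn. lia. }
    apply (L y 0). reflexivity.
  - apply Ho in H. subst y. step_machine. apply R.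
  - destruct H.
Qed.

Lemma final_push o s y t d K : final (run o s (ret y (push t d K))) ->
  exists s', s = S s' /\ final (run o s' (step_ret t d y K)).
Proof.
  intro H. destruct s as [|s].
  - exfalso. simpl in H. unfold final, ret, push in H.
    rewrite ?pr2_pair, ?pr2_pair in H. now destruct H.
  - exists s. now rewrite run_S, step_ret_eq in H.
Qed.

Ltac pop H s := apply final_push in H; destruct H as (s & -> & H); unfold step_ret in H;
  rewrite ?pr1_pair, ?pr2_pair, ?pr1_pair, ?pr2_pair in H;
  repeat match type of H with context [dec ?P] => destruct (dec P); try congruence end.

(** Induction on the fuel. The fuel [s'] left after the evaluation is strictly smaller, so the same
    hypothesis applies to whatever is run next from the stack. *)
Lemma run_eval (O : oracle) o : (forall x, O x (o x)) ->
  forall s e x K, final (run o s (ev e x K)) ->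
  exists y s', s' < s /\ eval O e x y /\ final (run o s' (ret y K)).
Proof.
  intros Ho s. induction s as [s IH] using lt_wf_ind. intros e x K H.
  destruct s as [|s]; [now apply ev_not_final in H|].
  rewrite run_S, step_ev_eq in H. unfold step_ev in H.
  assert (E : forall y s', eval_clause O e x y -> s' <= s -> final (run o s' (ret y K)) ->
    exists y s', s' < S s /\ eval O e x y /\ final (run o s' (ret y K))).
  { intros y s' Hy Hs Hf. exists y, s'. rewrite eval_iff. auto with arith. }
  unfold eval_clause in E.
  destruct (dec (pr1 e = 0)) as [Et|_]; [rewrite Et in *; eauto|].
  destruct (dec (pr1 e = 1)) as [Et|_]; [rewrite Et in *; eauto|].
  destruct (dec (pr1 e = 2)) as [Et|_]; [rewrite Et in *; eauto|].
  destruct (dec (pr1 e = 3)) as [Et|_]; [rewrite Et in *; eauto|].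
  destruct (dec (pr1 e = 4)) as [Et|_]; [rewrite Et in *; eauto|].
  destruct (dec (pr1 e = 5)) as [Et|_].
  { rewrite Et in *. apply IH in H; [|lia]. destruct H as (u & s1 & Hs1 & Hu & H).
    pop H t. apply IH in H; [|lia]. destruct H as (v & s2 & Hs2 & Hv & H).
    pop H t2. apply (E ⟨u, v⟩ t2); eauto; lia. }
  destruct (dec (pr1 e = 6)) as [Et|_].
  { rewrite Et in *. apply IH in H; [|lia]. destruct H as (u & s1 & Hs1 & Hu & H).
    pop H t. apply IH in H; [|lia]. destruct H as (v & s2 & Hs2 & Hv & H).
    apply (E v s2); eauto; lia. }
  destruct (dec (pr1 e = 7)) as [Et|_].
  { rewrite Et in *. destruct (pr2 x) as [|n].
    - destruct (dec (0 = 0)) as [_|]; [|tauto].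
      apply IH in H; [|lia]. destruct H as (u & s1 & Hs1 & Hu & H).
      apply (E u s1); eauto; lia.
    - destruct (dec (S n = 0)) as [|_]; [discriminate|]. simpl pred in H.
      apply IH in H; [|lia]. destruct H as (u & s1 & Hs1 & Hu & H).
      pop H t. apply IH in H; [|lia]. destruct H as (v & s2 & Hs2 & Hv & H).
      apply (E v s2); eauto; lia. }
  destruct (dec (pr1 e = 8)) as [Et|_].
  { rewrite Et in *.
    (* The candidates of a minimisation have no bound known in advance; the loop is followed by
       induction on the remaining fuel. *)
    assert (L : forall t i, t <= s ->
      (forall m, m < i -> exists k, eval O (pr2 e) ⟨x, m⟩ (S k)) ->
      final (run o t (ev (pr2 e) ⟨x, i⟩ (push 3 ⟨pr2 e, ⟨x, i⟩⟩ K))) ->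
      exists y s', s' <= s /\ eval O (pr2 e) ⟨x, y⟩ 0 /\
        (forall m, m < y -> exists k, eval O (pr2 e) ⟨x, m⟩ (S k)) /\
        final (run o s' (ret y K))).
    { intro t. induction t as [t IHt] using lt_wf_ind. intros i Ht Hi Hf.
      apply IH in Hf; [|lia]. destruct Hf as (u & s1 & Hs1 & Hu & Hf). pop Hf t'.
      - exists i, t'. subst u. refine (conj _ (conj Hu (conj Hi Hf))). lia.
      - destruct u as [|u]; [tauto|].
        apply (IHt t' ltac:(lia) (S i)); [lia| |exact Hf].
        intros m Hm. destruct (Nat.eq_dec m i) as [->|]; eauto. apply Hi. lia. }
    destruct (L s 0) as (y & s' & Hs & H0 & Hm & Hf); auto; [lia|].
    apply (E y s'); auto. }
  destruct (dec (pr1 e = 9)) as [Et|_]; [rewrite Et in *; eauto|].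
  apply IH in H; [|lia]. destruct H as (y & s1 & Hs1 & Hy & H).
  exists y, s1. auto with arith.
Qed.

Lemma eval_halts (O : oracle) o n : (forall x y, O x y <-> o x = y) ->
  (exists y, eval O (pr1 n) (pr2 n) y) <-> exists s, halts o s n.
Proof.
  intro Ho. split.
  - intros [y Hy]. apply (eval_run O o _ _ _ 0) in Hy; [|intros a b; apply Ho].
    destruct Hy as [s Hs]. exists s. unfold halts. rewrite Hs. apply ret_final.
  - intros [s Hs]. apply (run_eval O) in Hs; [|intro x; now apply Ho].
    destruct Hs as (y & _ & _ & Hy & _). eauto.
Qed.

(** Both derivations give runs of one deterministic machine, and a final state never changes
    again. *)
Lemma eval_fun (O : oracle) o e x y y' : (forall x y, O x y -> o x = y) ->
  eval O e x y -> eval O e x y' -> y = y'.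
Proof.
  intros Ho H H'. apply (eval_run O o _ _ _ 0) in H, H'; auto.
  destruct H as [s Hs], H' as [s' Hs'].
  assert (E : ret y 0 = ret y' 0).
  { destruct (Nat.le_ge_cases s s') as [L|L].
    - rewrite <- Hs'. replace s' with (s' - s + s) by lia.
      rewrite run_add, Hs, run_final; auto using ret_final.
    - rewrite <- Hs. replace s with (s - s' + s') by lia.
      rewrite run_add, Hs', run_final; auto using ret_final. }
  apply pair_inj in E. destruct E as [_ E]. now apply pair_inj in E.
Qed.

Lemma computes_step O o : computes O (fun z => o (pr1 z) (pr2 z)) ->
  computes O (fun z => step (o (pr1 z)) (pr2 z)).
Proof.
  intro Ho. unfold step, step_ev, step_ret, ev, ret, push. cbv zeta. comp.
Qed.

(** The machine oracle is a family indexed by a stage, so that one program can run the machine with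
    every approximation [approx b]. *)
Lemma T_red_halts O o : computes O (fun z => o (pr1 z) (pr2 z)) ->
  T_red (fun z => halts (o (pr1 z)) (pr1 (pr2 z)) (pr2 (pr2 z))) O.
Proof.
  intro Ho. unfold halts, final, run, ev.
  assert (Hr : computes O (fun z => Nat.iter (pr1 (pr2 z)) (step (o (pr1 z)))
    ⟨0, ⟨⟨pr1 (pr2 (pr2 z)), pr2 (pr2 (pr2 z))⟩, 0⟩⟩)).
  { apply (computes_iter _ _ (fun z w => step (o (pr1 z)) w)); comp.
    apply (computes_app2 _ (fun b w => step (o b) w)); [now apply computes_step| |]; comp. }
  apply T_red_and; [apply T_red_not|]; apply T_red_eq; comp; exact Hr.
Qed.

(** * Approximations to the jumps *)

Definition approx b n : nat := if dec (halts (fun _ => 0) b n) then 1 else 0.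

Lemma empty_oracle x y : set_oracle empty_set x y <-> 0 = y.
Proof. unfold set_oracle, empty_set. intuition. Qed.

Lemma zero'_halts n : zero' n <-> exists s, halts (fun _ => 0) s n.
Proof. apply eval_halts. intros x y. apply empty_oracle. Qed.

Lemma halts_mono o s s' n : s <= s' -> halts o s n -> halts o s' n.
Proof. apply final_le. Qed.

Lemma T_red_halts0 O : T_red (fun z => halts (fun _ => 0) (pr1 z) (pr2 z)) O.
Proof.
  apply (T_red_app3 O (fun b s n => halts ((fun _ _ => 0) b) s n) (fun _ => 0)); [|comp..].
  apply (T_red_halts O (fun _ _ => 0)), computes_const.
Qed.

Lemma run_eventually (O : nat -> nat -> nat) o s z :
  (forall x, exists b0, forall b, b0 <= b -> O b x = o x) ->
  exists b0, forall b, b0 <= b -> run (O b) s z = run o s z.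
Proof.
  intro Ho. induction s as [|s [b1 IH]]; [now exists 0|].
  (* A single step queries the oracle at most at the input component of the current state, so one
     further threshold is enough. *)
  destruct (Ho (pr2 (pr1 (pr2 (run o s z))))) as [b2 H2].
  exists (b1 + b2). intros b Hb. unfold run in *. simpl. rewrite IH by lia.
  unfold step, step_ev. rewrite H2 by lia. reflexivity.
Qed.

(* Fuel [s] bounds the oracle queries, so the approximations to [zero'] eventually
   answer all of them correctly: this is why one bound [s] can serve for all [b]. *)
Lemma zero''_sigma2 n : zero'' n <-> exists s, forall b, s <= b -> halts (approx b) s n.
Proof.
  set (o := fun x => if dec (zero' x) then 1 else 0).
  assert (Ho : forall x y, set_oracle zero' x y <-> o x = y).
  { intros x y. split; [apply set_oracle_fun|]. intros <-. apply set_oracle_chi. }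
  assert (Ha : forall x, exists b0, forall b, b0 <= b -> approx b x = o x).
  { intro x. unfold o, approx. destruct (dec (zero' x)) as [y|N].
    - apply zero'_halts in y. destruct y as [s Hs]. exists s. intros b Hb.
      destruct (dec (halts _ b x)) as [|N]; [reflexivity|].
      destruct N. now apply (halts_mono _ s).
    - exists 0. intros b _. destruct (dec (halts _ b x)) as [y|]; [|reflexivity].
      destruct N. apply zero'_halts. eauto. }
  assert (E : zero'' n <-> exists s, halts o s n) by (apply eval_halts, Ho).
  rewrite E. split.
  - intros [s Hs]. destruct (run_eventually approx o s (ev (pr1 n) (pr2 n) 0) Ha) as [b0 Hb].
    (* The fuel [s + b0] doubles as a stage from which all queries of the first [s] steps are
       answered correctly. *)
    exists (s + b0). intros b Hle. apply (halts_mono _ s); [lia|].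
    unfold halts. rewrite Hb by lia. exact Hs.
  - intros [s Hs]. destruct (run_eventually approx o s (ev (pr1 n) (pr2 n) 0) Ha) as [b0 Hb].
    exists s. unfold halts. rewrite <- (Hb (s + b0)) by lia. apply Hs. lia.
Qed.

Lemma T_red_halts_approx O :
  T_red (fun z => halts (approx (pr1 z)) (pr1 (pr2 z)) (pr2 (pr2 z))) O.
Proof.
  apply T_red_halts. unfold approx. pose proof (T_red_halts0 O). comp.
Qed.

(** * Unbounded quantifiers and the jump *)

Lemma T_red_jump X (R : nat -> nat -> Prop) :
  T_red (fun z => R (pr1 z) (pr2 z)) (set_oracle X) ->
  T_red (fun x => exists s, R x s) (set_oracle (jump X)).
Proof.
  intro HR. destruct (eval_search _ _ HR) as (e & f & He & Hf & Hs).
  assert (HJ : forall x, jump X ⟨e, x⟩ <-> exists s, R x s).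
  { intro x. unfold jump. rewrite pr1_pair, pr2_pair. split.
    - intros [n Hn]. exists n. apply eval_iff in Hn. unfold eval_clause in Hn.
      rewrite He, pr1_pair, pr2_pair in Hn. destruct Hn as [Hn _].
      (* If the search stopped at a number that fails [R], the program [f] would return both 0 and 1
         there. *)
      apply NNPP. intro N.
      assert (H1 : eval (set_oracle X) f ⟨x, n⟩ 1)
        by (apply Hf; now rewrite pr1_pair, pr2_pair).
      discriminate (eval_fun _ _ _ _ _ _ (set_oracle_fun X) Hn H1).
    - intro H. apply least_nat in H. destruct H as (n & Hn & Hm). exists n.
      apply Hs; [|intros m Hlt]; rewrite pr1_pair, pr2_pair; auto. }
  apply (T_red_ext _ (fun x => jump X ⟨e, x⟩)); [exact HJ|].
  pose proof (T_red_self (jump X)). apply (T_red_comp _ (jump X)); comp.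
Qed.

Lemma T_red_jump_all X (R : nat -> nat -> Prop) :
  T_red (fun z => R (pr1 z) (pr2 z)) (set_oracle X) ->
  T_red (fun x => forall s, R x s) (set_oracle (jump X)).
Proof.
  intro HR. apply (T_red_ext _ (fun x => ~ exists s, ~ R x s)).
  - intro x. split.
    + intros H s. apply NNPP. eauto.
    + intros H [s Hs]. auto.
  - apply T_red_not, (T_red_jump X (fun x s => ~ R x s)). now apply T_red_not.
Qed.

(** * Cardinalities *)

(** A stand-in for cardinality: comparing [size_ge] at every [n] compares finite and infinite
    classes alike. *)
Definition size_ge (P : nat -> Prop) n :=
  exists l, NoDup l /\ length l = n /\ forall x, In x l -> P x.

Lemma size_ge_0 P : size_ge P 0.
Proof. exists []. repeat split; [constructor|intros x []]. Qed.

Lemma size_ge_or P n :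
  size_ge P n \/ exists l, length l < n /\ forall x, P x -> In x l.
Proof.
  induction n as [|n [(l & Hl & Hn & HP)|(l & Hl & HP)]].
  - left. apply size_ge_0.
  - destruct (classic (exists x, P x /\ ~ In x l)) as [(x & Hx & Hi)|N].
    + left. exists (x :: l). simpl. repeat split; [now constructor|lia|].
      intros z [<-|Hz]; auto.
    + right. exists l. split; [lia|]. intros x Hx. apply NNPP. intro Hi. apply N. eauto.
  - right. exists l. split; [lia|exact HP].
Qed.

Lemma size_ge_bound P n l : size_ge P n -> (forall x, P x -> In x l) -> n <= length l.
Proof.
  intros (l' & Hl & <- & HP) H. apply NoDup_incl_length; [exact Hl|]. intros x Hx. auto.
Qed.

Lemma size_ge_le P n m : n <= m -> size_ge P m -> size_ge P n.
Proof.
  intros Hn Hm. destruct (size_ge_or P n) as [H|(l & Hl & HP)]; [exact H|].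
  pose proof (size_ge_bound P m l Hm HP). lia.
Qed.

Lemma infinite_size_ge P : ~ finite_set P <-> forall n, size_ge P n.
Proof.
  split.
  - intros H n. destruct (size_ge_or P n) as [|(l & _ & HP)]; [assumption|].
    destruct H. now exists l.
  - intros H [l HP]. pose proof (size_ge_bound P (S (length l)) l (H _) HP). lia.
Qed.

Lemma card_le_size_ge P k : card_le P k <-> ~ size_ge P (S k).
Proof.
  split.
  - intros (l & Hl & HP) H. pose proof (size_ge_bound P _ l H HP). lia.
  - intro H. destruct (size_ge_or P (S k)) as [|(l & Hl & HP)]; [tauto|].
    exists l. split; [lia|exact HP].
Qed.

Lemma pigeonhole (l L : list nat) (R : nat -> nat -> Prop) :
  NoDup l -> (forall y, In y l -> exists a, In a L /\ R a y) ->
  (forall a y y', In y l -> In y' l -> R a y -> R a y' -> y = y') ->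
  length l <= length L.
Proof.
  intros Hl HR Hf.
  pose (g := fun y => epsilon (inhabits 0) (fun a => In a L /\ R a y)).
  assert (Hg : forall y, In y l -> In (g y) L /\ R (g y) y)
    by (intros y Hy; apply epsilon_spec; auto).
  rewrite <- (length_map g l). apply NoDup_incl_length.
  - apply NoDup_map_NoDup_ForallPairs; [|exact Hl].
    intros y y' Hy Hy' E. apply (Hf (g y)); auto; [apply Hg, Hy|].
    rewrite E. apply Hg, Hy'.
  - intros a Ha. apply in_map_iff in Ha. destruct Ha as (y & <- & Hy). now apply Hg.
Qed.

(** * Greedy embeddings *)

(** A bi-embeddable copy is not given as an [equivalence_structure]. This is what it inherits along
    an embedding: the laws on its domain, with [rel] arbitrary elsewhere. *)
Definition equiv_on (B : structure) :=
  (forall x, dom B x -> rel B x x) /\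
  (forall x y, dom B x -> dom B y -> rel B x y -> rel B y x) /\
  (forall x y z, dom B x -> dom B y -> dom B z -> rel B x y -> rel B y z -> rel B x z).

Lemma equiv_on_embedding B A f :
  equivalence_structure A -> embedding B A f -> equiv_on B.
Proof.
  intros (_ & Hr & Hs & Ht) (Hd & _ & Hf). repeat split.
  - intros x Hx. apply Hf; auto.
  - intros x y Hx Hy H. apply Hf; auto. apply Hs. now apply Hf.
  - intros x y z Hx Hy Hz H H'. apply Hf; auto.
    apply (Ht _ (f y)); now apply Hf.
Qed.

Lemma size_ge_class B x y n : equiv_on B -> dom B x -> dom B y -> rel B x y ->
  size_ge (eq_class B x) n -> size_ge (eq_class B y) n.
Proof.
  intros (Hr & Hs & Ht) Hx Hy Hxy (l & Hl & Hn & HP). exists l. repeat split; auto.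
  - now apply HP.
  - destruct (HP x0 H) as [H1 H2]. apply (Ht _ x); auto.
Qed.

Lemma size_ge_embedding B C f x n : embedding B C f -> dom B x ->
  size_ge (eq_class B x) n -> size_ge (eq_class C (f x)) n.
Proof.
  intros (Hd & Hi & Hf) Hx (l & Hl & Hn & HP). exists (map f l). repeat split.
  - apply NoDup_map_NoDup_ForallPairs; [|exact Hl].
    intros a b Ha Hb. apply Hi; now apply HP.
  - now rewrite length_map.
  - apply in_map_iff in H. destruct H as (z & <- & Hz). apply Hd. now apply HP.
  - apply in_map_iff in H. destruct H as (z & <- & Hz). apply Hf; auto; now apply HP.
Qed.

Section Greedy.
Variables (B C : structure) (Q : nat -> nat -> Prop) (h0 : list (nat * nat)).
Hypotheses (EB : equiv_on B) (EC : equiv_on C).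

Definition fits (p q : nat * nat) :=
  (fst p = fst q <-> snd p = snd q) /\
  (rel B (fst p) (fst q) <-> rel C (snd p) (snd q)).

(** The clause on sizes keeps the construction alive: the class chosen in [C] has room for the whole
    class of [B], including elements not met yet. The guards on [dom B] are there because the
    history has an entry for every number. *)
Definition consistent (h : list (nat * nat)) :=
  (forall p, In p h -> dom B (fst p) -> dom C (snd p) /\
    forall n, size_ge (eq_class B (fst p)) n -> size_ge (eq_class C (snd p)) n) /\
  forall p q, In p h -> In q h -> dom B (fst p) -> dom B (fst q) -> fits p q.

Definition special x := exists p, In p h0 /\ dom B (fst p) /\ rel B x (fst p).

Hypothesis h0_consistent : consistent h0.
Hypothesis Q_fresh : forall x, dom B x -> ~ special x -> forall L,
  exists y, dom C y /\ (forall z, In z L -> dom C z -> ~ rel C y z) /\ Q x y.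
Hypothesis Q_size : forall x y, dom B x -> ~ special x -> dom C y -> Q x y ->
  forall n, size_ge (eq_class B x) n -> size_ge (eq_class C y) n.

(** Outside the domain of [B] every [y] is admissible, so the search stops at 0 and the history
    grows by one entry at each step. *)
Definition admissible (h : list (nat * nat)) x y :=
  dom B x -> dom C y /\
  (forall p, In p h -> dom B (fst p) -> fits (x, y) p) /\
  ((exists p, In p h /\ dom B (fst p) /\ rel B x (fst p)) \/ Q x y).

Lemma admissible_exists h x : incl h0 h -> consistent h -> exists y, admissible h x y.
Proof.
  intros Hi [H1 H2]. destruct EB as (Br & Bs & Bt), EC as (Cr & Cs & Ct).
  destruct (classic (dom B x)) as [Hx|N]; [|exists 0; now intro].
  (* In the construction this happens when [x] was matched beforehand; its value must then be
     repeated. *)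
  destruct (classic (exists p, In p h /\ fst p = x)) as [(p & Hp & Ep)|N1].
  { subst x. exists (snd p). intros _. split; [now apply H1|]. split.
    - intros q Hq Dq. exact (H2 p q Hp Hq Hx Dq).
    - left. exists p. auto. }
  destruct (classic (exists p, In p h /\ dom B (fst p) /\ rel B x (fst p)))
    as [(p & Hp & Dp & Rp)|N2].
  (* [L] lists the members of the class of [x] that already have values. With [x] they number one
     more than [L], and the target class is at least as large, so it has an element that is not a
     value of any of them. *)
  - pose (L := nodup Nat.eq_dec (map fst
      (filter (fun q => if dec (dom B (fst q) /\ rel B x (fst q)) then true else false) h))).
    assert (HL : forall z, In z L <-> dom B z /\ rel B x z /\ exists y, In (z, y) h).
    { intro z. unfold L. rewrite nodup_In, in_map_iff. split.
      - intros ([a b] & <- & Hq). apply filter_In in Hq. simpl in *.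
        destruct (dec _) as [[]|]; [|easy]. repeat split; try tauto. exists b. tauto.
      - intros (Dz & Rz & y & Hy). exists (z, y). split; [reflexivity|].
        apply filter_In. simpl. split; [exact Hy|]. destruct (dec _); tauto. }
    assert (S1 : size_ge (eq_class B (fst p)) (S (length L))).
    { exists (x :: L). repeat split.
      - constructor; [|apply NoDup_nodup]. intro I. apply HL in I.
        destruct I as (_ & _ & y & Hy). apply N1. exists (x, y). auto.
      - destruct H as [<-|H]; [exact Hx|]. now apply HL in H.
      - destruct H as [<-|H]; [now apply Bs|]. apply HL in H.
        apply (Bt _ x); try tauto. now apply Bs. }
    apply (H1 p Hp Dp) in S1. destruct S1 as (l & Hl & El & HPl).
    assert (Hy : exists y, In y l /\ ~ exists a, In a L /\ In (a, y) h).
    { apply NNPP. intro N.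
      assert (length l <= length L); [|lia].
      apply (pigeonhole l L (fun a y => dom B a /\ In (a, y) h)); [exact Hl| |].
      - intros y Hy. apply NNPP. intro N'. apply N. exists y. split; [exact Hy|].
        intros (a & Ha & Hay). apply N'. exists a. split; [exact Ha|].
        split; [|exact Hay]. now apply HL in Ha.
      - intros a y y' _ _ [Da I] [_ I'].
        apply (H2 (a, y) (a, y') I I' Da Da). reflexivity. }
    destruct Hy as (y & Hy & Ny). destruct (HPl y Hy) as [Dy Ry].
    destruct (H1 p Hp Dp) as [Dp' _].
    exists y. intros _. split; [exact Dy|]. split; [|left; eauto].
    intros q Hq Dq. destruct (H1 q Hq Dq) as [Dq' _].
    destruct (H2 p q Hp Hq Dp Dq) as [_ Rpq].
    assert (Rxq : rel B x (fst q) <-> rel C y (snd q)).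
    { split; intro R.
      - apply (Ct _ (snd p)); auto. apply Rpq. apply (Bt _ x); auto.
      - apply (Bt _ (fst p)); auto. apply Rpq. apply (Ct _ y); auto. }
    split; [|exact Rxq]. simpl. split; intro E; exfalso.
    + apply N1. exists q. auto.
    + apply Ny. exists (fst q). rewrite E, <- surjective_pairing. split; [|exact Hq].
      apply HL. repeat split; [exact Dq| |exists (snd q); now rewrite <- surjective_pairing].
      apply Rxq. rewrite E. now apply Cr.
  (* For a new class the target must avoid the class of every value used so far. *)
  - destruct (Q_fresh x Hx) with (L := map snd h) as (y & Dy & Ny & Qy).
    { intros (p & Hp & Dp & Rp). apply N2. exists p. auto. }
    exists y. intros _. split; [exact Dy|]. split; [|now right].
    intros q Hq Dq. destruct (H1 q Hq Dq) as [Dq' _].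
    assert (M : ~ rel C y (snd q)) by (apply Ny; [now apply in_map|exact Dq']).
    split; simpl; split; intro E; exfalso.
    + apply N1. eauto.
    + apply M. rewrite E. now apply Cr.
    + apply N2. eauto.
    + auto.
Qed.

Lemma consistent_cons h x y :
  incl h0 h -> consistent h -> admissible h x y -> consistent ((x, y) :: h).
Proof.
  intros Hi [H1 H2] Ha. destruct EB as (Br & Bs & Bt), EC as (Cr & Cs & Ct). split.
  - intros p [<-|Hp] Dp; [|now apply H1]. simpl in *. destruct (Ha Dp) as (Dy & Hf & Hq).
    split; [exact Dy|]. intros n Hn.
    (* An earlier member of the class of [x], if there is one, already guarantees the size; only a
       new class relies on [Q_size]. *)
    destruct (classic (exists p, In p h /\ dom B (fst p) /\ rel B x (fst p)))
      as [(p & Hp & Dp' & Rp)|N].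
    + destruct (H1 p Hp Dp') as [Dp'' Hs]. destruct (Hf p Hp Dp') as [_ Hr]. simpl in Hr.
      apply (size_ge_class C (snd p)); auto; [apply Cs; tauto|].
      apply Hs. apply (size_ge_class B x); auto.
    + destruct Hq as [|Hq]; [tauto|]. apply (Q_size x); auto.
      intros (p & Hp & Hp'). apply N. exists p. auto.
  - intros p q [<-|Hp] [<-|Hq] Dp Dq; simpl in Dp, Dq.
    + destruct (Ha Dp) as (Dy & _). split; simpl; [tauto|]. split; auto.
    + now apply (Ha Dp).
    + destruct (Ha Dq) as (Dy & Hf & _). destruct (Hf p Hp Dp) as [E R]. simpl in E, R.
      destruct (H1 p Hp Dp) as [Dp' _].
      split; simpl; [split; intro; symmetry; apply E; auto|].
      split; intro; [apply Cs|apply Bs]; auto; apply R; [apply Bs|apply Cs]; auto.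
    + now apply H2.
Qed.

Definition pick h x :=
  match dec (exists y, admissible h x y) with
  | left H => proj1_sig (constructive_indefinite_description _ (least_nat _ H))
  | right _ => 0
  end.

Fixpoint history n :=
  match n with
  | 0 => h0
  | S x => (x, pick (history x) x) :: history x
  end.

Definition greedy x := pick (history x) x.

Lemma pick_spec h x : (exists y, admissible h x y) ->
  admissible h x (pick h x) /\ forall m, m < pick h x -> ~ admissible h x m.
Proof.
  intro H. unfold pick. destruct (dec _) as [H'|]; [|tauto].
  now destruct (constructive_indefinite_description _ _).
Qed.

Lemma history_consistent n : incl h0 (history n) /\ consistent (history n).
Proof.
  induction n as [|n [Hi Hc]]; simpl; [split; auto; apply incl_refl|].
  split; [now apply incl_tl|]. apply consistent_cons; auto.
  apply pick_spec. now apply admissible_exists.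
Qed.

Lemma history_admissible n :
  admissible (history n) n (greedy n) /\
  forall m, m < greedy n -> ~ admissible (history n) n m.
Proof. apply pick_spec, admissible_exists; apply history_consistent. Qed.

Lemma history_In x n : x < n -> In (x, greedy x) (history n).
Proof.
  induction n as [|n IH]; intro H; [lia|]. simpl.
  destruct (Nat.eq_dec x n) as [->|]; [now left|]. right. apply IH. lia.
Qed.

Lemma greedy_embedding : embedding B C greedy.
Proof.
  assert (F : forall x y, dom B x -> dom B y -> fits (x, greedy x) (y, greedy y)).
  { intros x y Dx Dy. destruct (history_consistent (S (x + y))) as [_ [_ H]].
    apply H; auto; apply history_In; lia. }
  split; [|split].
  - intros x Dx. now apply history_admissible.
  - intros x y Dx Dy. apply (F x y Dx Dy).
  - intros x y Dx Dy. apply (F x y Dx Dy).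
Qed.

(** * Coding histories as numbers *)

Definition nthc c k := pr1 (Nat.iter k (fun r => pr2 r) c).

(** The length is not stored: after [n] steps it is [n] plus the length of [h0]. *)
Fixpoint encode (h : list (nat * nat)) :=
  match h with [] => 0 | p :: h => ⟨⟨fst p, snd p⟩, encode h⟩ end.

Lemma In_encode h p :
  In p h <-> exists k, k < length h /\ nthc (encode h) k = ⟨fst p, snd p⟩.
Proof.
  induction h as [|q h IH]; simpl; [split; [tauto|intros (k & H & _); lia]|].
  rewrite IH. unfold nthc. split.
  - intros [->|(k & Hk & E)].
    + exists 0. split; [lia|]. simpl. now rewrite pr1_pair.
    + exists (S k). split; [lia|]. now rewrite Nat.iter_succ_r, pr2_pair.
  - intros ([|k] & Hk & E).
    + simpl in E. rewrite pr1_pair in E. apply pair_inj in E. left.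
      destruct p, q; simpl in *; f_equal; tauto.
    + right. exists k. rewrite Nat.iter_succ_r, pr2_pair in E. split; [lia|exact E].
Qed.

(** Quantifiers over list entries become bounded quantifiers over positions, so decidability follows
    from that of the two structures and [Q]. *)
Definition admissible_code c n x y :=
  dom B x -> dom C y /\
  (forall k, k < n -> dom B (pr1 (nthc c k)) ->
    (x = pr1 (nthc c k) <-> y = pr2 (nthc c k)) /\
    (rel B x (pr1 (nthc c k)) <-> rel C y (pr2 (nthc c k)))) /\
  ((exists k, k < n /\ dom B (pr1 (nthc c k)) /\ rel B x (pr1 (nthc c k))) \/ Q x y).

Lemma admissible_encode h x y :
  admissible_code (encode h) (length h) x y <-> admissible h x y.
Proof.
  assert (E : forall k, k < length h ->
    In (pr1 (nthc (encode h) k), pr2 (nthc (encode h) k)) h).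
  { intros k Hk. apply In_encode. exists k. simpl. now rewrite pair_pr. }
  unfold admissible_code, admissible.
  assert (E1 : (forall k, k < length h -> dom B (pr1 (nthc (encode h) k)) ->
    (x = pr1 (nthc (encode h) k) <-> y = pr2 (nthc (encode h) k)) /\
    (rel B x (pr1 (nthc (encode h) k)) <-> rel C y (pr2 (nthc (encode h) k)))) <->
    forall p, In p h -> dom B (fst p) -> fits (x, y) p).
  { split; intro H.
    - intros p Hp Dp. apply In_encode in Hp. destruct Hp as (k & Hk & Ek).
      specialize (H k Hk). rewrite Ek, pr1_pair, pr2_pair in H. now apply H.
    - intros k Hk Dk. apply (H _ (E k Hk) Dk). }
  assert (E2 : (exists k, k < length h /\ dom B (pr1 (nthc (encode h) k)) /\
      rel B x (pr1 (nthc (encode h) k))) <->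
    exists p, In p h /\ dom B (fst p) /\ rel B x (fst p)).
  { split.
    - intros (k & Hk & H). exists (pr1 (nthc (encode h) k), pr2 (nthc (encode h) k)). auto.
    - intros (p & Hp & H). apply In_encode in Hp. destruct Hp as (k & Hk & Ek).
      exists k. rewrite Ek, pr1_pair. auto. }
  rewrite E1, E2. reflexivity.
Qed.

Lemma greedy_computes O :
  T_red (dom B) O -> T_red (fun z => rel B (pr1 z) (pr2 z)) O ->
  T_red (dom C) O -> T_red (fun z => rel C (pr1 z) (pr2 z)) O ->
  T_red (fun z => Q (pr1 z) (pr2 z)) O -> computes O greedy.
Proof.
  intros DB RB DC RC DQ. set (s := length h0).
  assert (Hlen : forall n, length (history n) = n + s) by (induction n; simpl; auto).
  destruct (eval_search O (fun z => admissible_code (pr2 (pr2 (pr1 z)))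
    (pr1 (pr2 (pr1 z)) + s) (pr1 (pr2 (pr1 z))) (pr2 z))) as (e & _ & _ & _ & He).
  { unfold admissible_code, nthc. comp. }
  assert (E : forall x n, eval O e ⟨x, ⟨n, encode (history n)⟩⟩ (greedy n)).
  { intros x n. destruct (history_admissible n) as [H1 H2].
    apply He; [|intros m Hm]; rewrite ?pr1_pair, ?pr2_pair, ?pr1_pair, ?pr2_pair,
      ?pr1_pair, ?pr2_pair, <- Hlen, admissible_encode; auto. }
  destruct (computes_pr1 O _ (computes_pr2 O _ (computes_id O))) as [d1 Hd1].
  destruct (computes_pr2 O _ (computes_pr2 O _ (computes_id O))) as [d2 Hd2].
  assert (G : computes O (fun z => encode (history (pr2 z)))).
  { apply (computes_iter_along O (fun _ n => encode (history n)) ⟨5, ⟨⟨5, ⟨d1, e⟩⟩, d2⟩⟩).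
    - apply computes_const.
    - intros x n. simpl.
      eapply ev_pair; try apply cancel_of_to; [eapply ev_pair; try apply cancel_of_to|].
      + specialize (Hd1 ⟨x, ⟨n, encode (history n)⟩⟩).
        now rewrite pr2_pair, pr1_pair in Hd1.
      + apply E.
      + specialize (Hd2 ⟨x, ⟨n, encode (history n)⟩⟩).
        now rewrite pr2_pair, pr2_pair in Hd2. }
  (* The value at [x] is the second half of the newest entry of the history of length [S x] beyond
     [h0]. *)
  apply (computes_ext O (fun x => pr2 (pr1 ((fun z => encode (history (pr2 z))) ⟨0, S x⟩)))).
  - intro x. cbv beta. rewrite pr2_pair. simpl. now rewrite pr1_pair, pr2_pair.
  - apply computes_pr2, computes_pr1, (computes_comp O _ _ G). comp.
Qed.

End Greedy.

(** * Counting elements of classes *)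

Definition count (P : nat -> Prop) n : nat :=
  nat_rect (fun _ => nat) 0 (fun i r => if dec (P i) then S r else r) n.

Lemma count_list P n :
  exists l, NoDup l /\ length l = count P n /\ forall x, In x l <-> x < n /\ P x.
Proof.
  induction n as [|n (l & Hl & Hc & HP)].
  - exists []. split; [constructor|]. split; [reflexivity|]. intro x. simpl. intuition lia.
  - simpl. destruct (dec (P n)) as [H|H].
    + exists (n :: l). simpl. split; [|split; [auto|]].
      * constructor; [|exact Hl]. intro I. apply HP in I. lia.
      * intro x. rewrite HP. split; [intros [<-|]; auto; intuition lia|].
        intros [Hx Px]. destruct (Nat.eq_dec x n); [now left|]. right. split; [lia|exact Px].
    + exists l. split; [exact Hl|split; [exact Hc|]]. intro x. rewrite HP. split; [intuition lia|].
      intros [Hx Px]. split; [|exact Px]. destruct (Nat.eq_dec x n); [now subst|lia].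
Qed.

Lemma size_ge_count P n m : m <= count P n -> size_ge P m.
Proof.
  intro Hm. apply (size_ge_le _ _ _ Hm). destruct (count_list P n) as (l & Hl & Hc & HP).
  exists l. repeat split; auto. intros x Hx. now apply HP.
Qed.

Lemma count_ge P n l : NoDup l -> (forall x, In x l -> x < n /\ P x) -> length l <= count P n.
Proof.
  intros Hl H. destruct (count_list P n) as (l' & Hl' & <- & HP).
  apply NoDup_incl_length; [exact Hl|]. intros x Hx. now apply HP, H.
Qed.

Lemma size_ge_count_iff P m : size_ge P m <-> exists n, m <= count P n.
Proof.
  split; [|intros [n Hn]; now apply (size_ge_count P n)].
  intros (l & Hl & <- & HP). exists (S (list_max l)). apply count_ge; [exact Hl|].
  intros x Hx. split; [|auto].
  pose proof (proj1 (list_max_le l (list_max l)) (le_n _)) as F.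
  rewrite Forall_forall in F. apply F in Hx. lia.
Qed.

Lemma count_class B x y n : equiv_on B -> dom B x -> dom B y -> rel B x y ->
  count (eq_class B x) n <= count (eq_class B y) n.
Proof.
  intros (Br & Bs & Bt) Hx Hy Hxy. destruct (count_list (eq_class B x) n) as (l & Hl & <- & HP).
  apply count_ge; [exact Hl|]. intros z Hz. apply HP in Hz. destruct Hz as (Hz & Dz & Rz).
  split; [exact Hz|]. split; [exact Dz|]. apply (Bt _ x); auto.
Qed.

(** The greatest of [m] members is its own certificate: counting up to it already finds them all.
    Searching through such elements turns the Sigma1 condition of having [m] elements into a
    decidable one. *)
Lemma late_member B y m : equiv_on B -> dom B y -> size_ge (eq_class B y) m ->
  exists y', dom B y' /\ rel B y y' /\ m <= count (eq_class B y') (S y').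
Proof.
  intros EB Dy (l & Hl & <- & HP). destruct l as [|a l].
  { exists y. repeat split; auto; [now apply (proj1 EB)|simpl; lia]. }
  set (l' := a :: l) in *.
  assert (M : exists y', In y' l' /\ forall z, In z l' -> z <= y').
  { clear. unfold l'. clear l'. revert a. induction l as [|b l IH]; intro a.
    - exists a. split; [now left|]. intros z [<-|[]]. lia.
    - destruct (IH b) as (y' & Hy & Hm). destruct (Nat.le_ge_cases a y') as [L|L].
      + exists y'. split; [now right|]. intros z [<-|Hz]; auto.
      + exists a. split; [now left|]. intros z [<-|Hz]; auto.
        apply Hm in Hz. lia. }
  destruct M as (y' & Hy & Hm). destruct (HP y' Hy) as [Dy' Ry'].
  exists y'. repeat split; auto.
  apply Nat.le_trans with (count (eq_class B y) (S y')); [|now apply count_class].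
  apply count_ge; [exact Hl|]. intros z Hz. split; [apply Hm in Hz; lia|auto].
Qed.

Lemma computes_count O B :
  T_red (dom B) O -> T_red (fun z => rel B (pr1 z) (pr2 z)) O ->
  computes O (fun z => count (eq_class B (pr1 z)) (pr2 z)).
Proof.
  intros HD HR. unfold count.
  apply (computes_rec O (fun _ => 0)
    (fun z i r => if dec (eq_class B (pr1 z) i) then S r else r)); unfold eq_class; comp.
Qed.

(** * Systems of representatives *)

Definition inf_class B x := forall n, size_ge (eq_class B x) n.

Definition cover (B : structure) (Big : nat -> Prop) := exists l, forall x,
  dom B x -> Big x -> exists r, In r l /\ dom B r /\ rel B x r.

Definition reps (B : structure) (Big : nat -> Prop) l :=
  NoDup l /\ (forall r, In r l -> dom B r /\ Big r) /\
  (forall r r', In r l -> In r' l -> rel B r r' -> r = r') /\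
  (forall x, dom B x -> Big x -> exists r, In r l /\ rel B x r).

Lemma reps_cover B Big l : reps B Big l -> cover B Big.
Proof.
  intros (_ & H & _ & Hc). exists l. intros x Dx Hx. destruct (Hc x Dx Hx) as (r & Hr & R).
  exists r. repeat split; auto. now apply H.
Qed.

Lemma cover_reps B Big : equiv_on B -> cover B Big -> exists l, reps B Big l.
Proof.
  intros (Br & Bs & Bt) [l Hl].
  assert (H : exists l', NoDup l' /\ (forall r, In r l' -> dom B r /\ Big r) /\
    (forall r r', In r l' -> In r' l' -> rel B r r' -> r = r') /\
    (forall x, dom B x -> Big x -> (exists r, In r l /\ dom B r /\ rel B x r) ->
      exists r, In r l' /\ rel B x r)).
  { clear Hl. induction l as [|r l (l' & Hn & Hb & Hi & Hc)].
    - exists []. repeat split; try (now constructor); try easy. intros x _ _ (r & [] & _).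
    (* [r] itself need not satisfy [Big]; an element [x] of its class that does is taken instead,
       unless the classes represented so far already contain all of these. *)
    - destruct (classic (exists x, dom B x /\ Big x /\ dom B r /\ rel B x r /\
        ~ exists r', In r' l' /\ rel B x r')) as [(x & Dx & Bx & Dr & Rx & Nx)|N].
      + exists (x :: l'). split; [|split; [|split]].
        * constructor; [|exact Hn]. intro I. apply Nx. exists x. auto.
        * intros z [<-|Hz]; auto.
        * intros z z' [<-|Hz] [<-|Hz'] R; auto; exfalso; apply Nx; [eauto|].
          exists z. split; [exact Hz|]. apply Bs; auto. now apply Hb.
        * intros z Dz Bz (r' & [<-|Hr'] & Dr' & R).
          -- exists x. split; [now left|]. apply (Bt _ r); auto.
          -- destruct (Hc z Dz Bz) as (s & Hs & Rs); [eauto|]. exists s. split; [now right|auto].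
      + exists l'. repeat split; auto; try now apply Hb.
        intros z Dz Bz (r' & [<-|Hr'] & Dr' & R); [|apply Hc; eauto].
        apply NNPP. intro N'. apply N. exists z. auto 6. }
  destruct H as (l' & H1 & H2 & H3 & H4). exists l'. repeat split; auto; now apply H2.
Qed.

(* Pulling back along [g] embeds the big classes of [C] into those of [B], so
   finitely many of them are exhausted by the images under [f]. *)
Lemma reps_map B C f g (BigB BigC : nat -> Prop) l :
  equiv_on B -> equiv_on C -> embedding B C f -> embedding C B g ->
  (forall x, dom B x -> BigB x -> BigC (f x)) ->
  (forall x, dom C x -> BigC x -> BigB (g x)) ->
  reps B BigB l -> reps C BigC (map f l).
Proof.
  intros (Br & Bs & Bt) (Cr & Cs & Ct) (Fd & Fi & Fr) (Gd & Gi & Gr) HF HG (H1 & H2 & H3 & H4).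
  assert (P1 : NoDup (map f l)).
  { apply NoDup_map_NoDup_ForallPairs; [|exact H1]. intros a b Ha Hb. now apply Fi; apply H2. }
  assert (P2 : forall r, In r (map f l) -> dom C r /\ BigC r).
  { intros r Hr. apply in_map_iff in Hr. destruct Hr as (a & <- & Ha).
    destruct (H2 a Ha). auto. }
  assert (P3 : forall r r', In r (map f l) -> In r' (map f l) -> rel C r r' -> r = r').
  { intros r r' Hr Hr' R. apply in_map_iff in Hr, Hr'.
    destruct Hr as (a & <- & Ha), Hr' as (b & <- & Hb). f_equal.
    apply H3; auto. apply Fr; auto; now apply H2. }
  repeat split; auto; try now apply P2.
  intros c Dc Bc. apply NNPP. intro N.
  assert (L : length (c :: map f l) <= length l); [|simpl in L; rewrite length_map in L; lia].
  assert (Q2 : forall y, In y (c :: map f l) -> dom C y /\ BigC y)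
    by (intros y [<-|Hy]; auto).
  apply (pigeonhole _ _ (fun a y => dom B a /\ rel B (g y) a)).
  - constructor; [|exact P1]. intro I. apply N. exists c. auto.
  - intros y Hy. destruct (Q2 y Hy) as [Dy By].
    destruct (H4 (g y)) as (r & Hr & R); auto. exists r. repeat split; auto. now apply H2.
  - intros a y y' Hy Hy' [Da R] [_ R']. destruct (Q2 y Hy) as [Dy _], (Q2 y' Hy') as [Dy' _].
    assert (E : rel C y y') by (apply Gr; auto; apply (Bt _ a); auto).
    destruct Hy as [<-|Hy], Hy' as [<-|Hy']; auto; exfalso; apply N; eauto.
Qed.

(** Taking [J] to be everything gives the infinite classes, a single number [m] the classes with at
    least [m] elements. *)
Lemma cover_transfer A B (J : nat -> Prop) : equiv_on A -> equiv_on B -> bi_embeddable A B ->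
  cover A (fun x => forall n, J n -> size_ge (eq_class A x) n) ->
  cover B (fun x => forall n, J n -> size_ge (eq_class B x) n).
Proof.
  intros EA EB [[f Hf] [g Hg]] H. apply cover_reps in H; [|exact EA]. destruct H as [l Hl].
  apply (reps_cover _ _ (map f l)).
  apply (reps_map A B f g (fun x => forall n, J n -> size_ge (eq_class A x) n)); auto;
    intros x Dx Hx n Hn; [apply (size_ge_embedding A B)|apply (size_ge_embedding B A)]; auto.
Qed.

(** Only the finitely many values of [f] on [l] enter the program, so [f] may be of any
    complexity. *)
Lemma embedding_from_reps B C Big f l Q : equiv_on B -> equiv_on C ->
  reps B Big l ->
  (forall r, In r l -> dom C (f r) /\
    forall n, size_ge (eq_class B r) n -> size_ge (eq_class C (f r)) n) ->
  (forall r r', In r l -> In r' l -> rel C (f r) (f r') -> r = r') ->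
  (forall x, dom B x -> ~ Big x -> forall L,
    exists y, dom C y /\ (forall z, In z L -> dom C z -> ~ rel C y z) /\ Q x y) ->
  (forall x y, dom B x -> ~ Big x -> dom C y -> Q x y ->
    forall n, size_ge (eq_class B x) n -> size_ge (eq_class C y) n) ->
  exists g, embedding B C g /\
    forall O, computable_structure B -> computable_structure C ->
      T_red (fun z => Q (pr1 z) (pr2 z)) O -> computes O g.
Proof.
  intros EB EC (H1 & H2 & H3 & H4) Hf Hi HQ HS.
  pose (h0 := map (fun r => (r, f r)) l).
  assert (Hh : forall p, In p h0 -> In (fst p) l /\ p = (fst p, f (fst p))).
  { intros p Hp. apply in_map_iff in Hp. destruct Hp as (r & <- & Hr). auto. }
  assert (Hs : forall x, dom B x -> ~ special B h0 x -> ~ Big x).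
  { intros x Dx N Bx. destruct (H4 x Dx Bx) as (r & Hr & R). apply N.
    exists (r, f r). simpl. repeat split; auto; [|now apply H2].
    apply in_map_iff. eauto. }
  assert (Hc : consistent B C h0).
  { split.
    - intros p Hp Dp. destruct (Hh p Hp) as [I E]. rewrite E. simpl. now apply Hf.
    - intros p q Hp Hq Dp Dq. destruct (Hh p Hp) as [Ip Ep], (Hh q Hq) as [Iq Eq].
      rewrite Ep, Eq. revert Ip Iq. generalize (fst p) as a, (fst q) as b. intros a b Ia Ib.
      assert (E : a = b <-> rel B a b).
      { split; [intros <-; now apply (proj1 EB), H2|auto]. }
      assert (E' : a = b <-> rel C (f a) (f b)).
      { split; [intros <-; now apply (proj1 EC), Hf|auto]. }
      split; simpl.
      + split; [congruence|]. intro F. apply E'. rewrite F. now apply (proj1 EC), Hf.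
      + now rewrite <- E, E'. }
  exists (greedy B C Q h0). split.
  - apply greedy_embedding; auto. intros x y Dx N. apply HS; auto.
  - intros O [DB RB] [DC RC] DQ.
    apply greedy_computes; auto using computable_T_red.
    intros x y Dx N. apply HS; auto.
Qed.

(** * Upper bounds *)

(** Computability is conditional so that the same constructions also prove bare bi-embeddability. *)
Definition effective_embedding X B C := exists g, embedding B C g /\
  (computable_structure B -> computable_structure C -> computes (set_oracle X) g).

Definition unbounded_finite_classes B := forall n,
  exists x, dom B x /\ ~ inf_class B x /\ size_ge (eq_class B x) n.

(** With the classes of size at least [S m] matched beforehand, the remaining ones have at most [m]
    elements, and infinitely many classes of [C] can hold that many. *)
Lemma embedding_bounded B C m : equiv_on B -> equiv_on C -> bi_embeddable B C ->
  cover B (fun x => size_ge (eq_class B x) (S m)) ->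
  ~ cover C (fun x => size_ge (eq_class C x) m) ->
  effective_embedding empty_set B C.
Proof.
  intros EB EC [[f Hf] _] HB HC. apply cover_reps in HB; [|exact EB]. destruct HB as [l Hl].
  destruct (embedding_from_reps B C _ f l (fun _ y => m <= count (eq_class C y) (S y)) EB EC Hl)
    as (g & Hg & Cg).
  - intros r Hr. destruct Hl as (_ & Hl & _). destruct (Hl r Hr) as [Dr _].
    split; [now apply Hf|]. intro n. now apply size_ge_embedding.
  - intros r r' Hr Hr' R. destruct Hl as (_ & H2 & H3 & _). apply H3; auto.
    apply Hf; auto; now apply H2.
  - intros _ _ _ L. apply NNPP. intro N. apply HC. exists L. intros y Dy Hy.
    destruct (late_member C y m EC Dy Hy) as (y' & Dy' & R & Hy').
    apply NNPP. intro N'. apply N. exists y'. repeat split; auto.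
    intros z Hz Dz Rz. apply N'. exists z. repeat split; auto. now apply (proj2 (proj2 EC) _ y').
  - intros x y Dx Nx Dy Hy n Hn.
    apply (size_ge_le _ _ m); [|now apply (size_ge_count _ (S y))].
    destruct (Nat.le_gt_cases n m); [assumption|].
    destruct Nx. now apply (size_ge_le _ _ n).
  - exists g. split; [exact Hg|]. intros CB CC. apply Cg; auto.
    pose proof (computes_count (set_oracle empty_set) C (proj1 CC) (proj2 CC)) as HK.
    comp. apply (computes_app2 _ (fun y s => count (eq_class C y) s)); comp.
Qed.

Lemma embedding_unbounded B C f l : equiv_on B -> equiv_on C ->
  reps B (inf_class B) l ->
  (forall r, In r l -> dom C (f r) /\ inf_class C (f r)) ->
  (forall r r', In r l -> In r' l -> rel C (f r) (f r') -> r = r') ->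
  unbounded_finite_classes C ->
  effective_embedding zero' B C.
Proof.
  intros EB EC Hl Hf Hi HC.
  (* Counting in [C] only up to [S y] leaves a single universal quantifier, over the stages of [B],
     so [Q] is Pi1. *)
  destruct (embedding_from_reps B C _ f l
    (fun x y => forall s, count (eq_class B x) s <= count (eq_class C y) (S y)) EB EC Hl)
    as (g & Hg & Cg); auto.
  - intros r Hr. destruct (Hf r Hr) as [Dr Ir]. split; [exact Dr|]. intros n _. apply Ir.
  - intros x Dx Nx L.
    assert (Hn : exists n, forall s, count (eq_class B x) s <= n).
    { apply not_all_ex_not in Nx. destruct Nx as [n Hn]. exists n. intro s.
      destruct (Nat.le_gt_cases (count (eq_class B x) s) n) as [|H]; [assumption|].
      destruct Hn. apply (size_ge_count _ s). lia. }
    destruct Hn as [n Hn].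
    (* [N] exceeds the size of every finite class that meets [L]. A finite class with at least
       [n + N] elements is therefore new, and large enough for [x]. *)
    assert (HN : exists N, forall z, In z L -> size_ge (eq_class C z) N -> inf_class C z).
    { clear - L. induction L as [|z L [N IH]]; [exists 0; intros z []|].
      destruct (classic (inf_class C z)) as [I|I].
      - exists N. intros z' [<-|Hz]; auto.
      - apply not_all_ex_not in I. destruct I as [k Hk]. exists (N + k).
        intros z' [<-|Hz'] S'.
        + destruct Hk. apply (size_ge_le _ _ (N + k)); [lia|exact S'].
        + apply IH; [exact Hz'|]. apply (size_ge_le _ _ (N + k)); [lia|exact S']. }
    destruct HN as [N HN]. destruct (HC (n + N)) as (y & Dy & Fy & Sy).
    destruct (late_member C y _ EC Dy Sy) as (y' & Dy' & R & Hy').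
    exists y'. split; [exact Dy'|]. split.
    + intros z Hz Dz Rz. apply Fy. intro k.
      assert (Ryz : rel C y z) by (apply (proj2 (proj2 EC) _ y'); auto).
      apply (size_ge_class C z); auto; [now apply (proj1 (proj2 EC))|]. apply HN; [exact Hz|].
      apply (size_ge_class C y); auto. apply (size_ge_le _ _ (n + N)); [lia|exact Sy].
    + intro s. specialize (Hn s). lia.
  - intros x y Dx Nx Dy Hy n Hn. apply size_ge_count_iff in Hn. destruct Hn as [s Hs].
    apply (size_ge_count _ (S y)). specialize (Hy s). lia.
  - exists g. split; [exact Hg|]. intros CB CC. apply Cg; auto.
    apply (T_red_jump_all empty_set
      (fun p s => count (eq_class B (pr1 p)) s <= count (eq_class C (pr2 p)) (S (pr2 p)))).
    pose proof (computes_count (set_oracle empty_set) B (proj1 CB) (proj2 CB)) as HB.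
    pose proof (computes_count (set_oracle empty_set) C (proj1 CC) (proj2 CC)) as HK.
    comp.
    + apply (computes_app2 _ (fun y s => count (eq_class B y) s)); comp.
    + apply (computes_app2 _ (fun y s => count (eq_class C y) s)); comp.
Qed.

(** Nothing is matched beforehand: an infinite class can host any class, and there is always a new
    one, so [Q] does not depend on [x]. *)
Lemma embedding_infinite B C : equiv_on B -> equiv_on C ->
  ~ cover C (inf_class C) -> effective_embedding zero'' B C.
Proof.
  intros EB EC HC.
  destruct (embedding_from_reps B C (fun _ => False) id [] (fun _ y => inf_class C y) EB EC)
    as (g & Hg & Cg); try easy.
  - repeat split; try easy. constructor.
  - intros x _ _ L. apply NNPP. intro N. apply HC. exists L. intros y Dy Iy.
    apply NNPP. intro N'. apply N. exists y. repeat split; auto.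
    intros z Hz Dz R. apply N'. eauto.
  - exists g. split; [exact Hg|]. intros CB CC. apply Cg; auto.
    pose proof (computes_count (set_oracle empty_set) C (proj1 CC) (proj2 CC)) as HK.
    (* Infinitude in Pi2 form: for every [n] some stage shows [n] elements. Each quantifier costs
       one jump. *)
    apply (T_red_ext _ (fun z => forall n, exists s, n <= count (eq_class C (pr2 z)) s)).
    { intro z. split; intros H n; apply size_ge_count_iff; apply H. }
    apply (T_red_jump_all zero' (fun z n => exists s, n <= count (eq_class C (pr2 z)) s)).
    apply (T_red_jump empty_set
      (fun w s => pr2 w <= count (eq_class C (pr2 (pr1 w))) s)).
    comp. apply (computes_app2 _ (fun y s => count (eq_class C y) s)); comp.
Qed.

(** * Bi-embeddability and its invariants *)

Lemma equiv_structure_on A : equivalence_structure A -> equiv_on A.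
Proof.
  intros (_ & Hr & Hs & Ht). repeat split; auto. intros x y z _ _ _. apply Ht.
Qed.

Lemma embedding_comp A B C f g :
  embedding A B f -> embedding B C g -> embedding A C (fun x => g (f x)).
Proof.
  intros (Fd & Fi & Fr) (Gd & Gi & Gr). repeat split; auto.
  - intro R. apply Gr; auto. now apply Fr.
  - intro R. apply Fr; auto. apply Gr; auto.
Qed.

Lemma bi_embeddable_sym A B : bi_embeddable A B -> bi_embeddable B A.
Proof. unfold bi_embeddable. tauto. Qed.

Lemma bi_embeddable_trans A B C :
  bi_embeddable A B -> bi_embeddable B C -> bi_embeddable A C.
Proof.
  intros [[f Hf] [f' Hf']] [[g Hg] [g' Hg']].
  split; eexists; eapply embedding_comp; eauto.
Qed.

Lemma computes_biemb_intro A X : equivalence_structure A ->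
  (forall B C, equiv_on B -> equiv_on C -> bi_embeddable A B -> bi_embeddable A C ->
    effective_embedding X B C) ->
  computes_biemb A X.
Proof.
  intros EA H B C CB CC HB HC.
  assert (EB : equiv_on B) by (destruct HB as [[f Hf] _]; now apply (equiv_on_embedding B A f)).
  assert (EC : equiv_on C) by (destruct HC as [[f Hf] _]; now apply (equiv_on_embedding C A f)).
  apply bi_embeddable_sym in HB, HC.
  destruct (H B C) as (f & Hf & Cf); auto. destruct (H C B) as (g & Hg & Cg); auto.
  split; [exists f|exists g]; auto.
Qed.

(** Leastness follows from strength: an oracle that suffices for all copies computes embeddings
    between [A0] and [A1], hence their join, hence [X]. *)
Lemma strong_degree_intro A X A0 A1 :
  computes_biemb A X -> computable_structure A0 -> computable_structure A1 ->
  bi_embeddable A0 A -> bi_embeddable A1 A ->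
  (forall mu nu, embedding A0 A1 mu -> embedding A1 A0 nu -> T_red X (join_oracle mu nu)) ->
  strong_BE_cat_degree A X.
Proof.
  intros HX C0 C1 B0 B1 H. split; [split; [exact HX|]|exists A0, A1; auto].
  intros Y HY. destruct (HY A0 A1) as [(mu & Cmu & Hmu) (nu & Cnu & Hnu)]; auto.
  apply (T_red_join_trans _ mu nu); auto.
Qed.

Lemma finitely_many_cover A : equivalence_structure A ->
  finitely_many_infinite_classes A <-> cover A (inf_class A).
Proof.
  intros (Hd & _). split.
  - intros [l Hl]. exists l. intros x Dx Ix. apply infinite_size_ge in Ix.
    destruct (Hl x Dx Ix) as (r & Hr & R). exists r. repeat split; auto. now apply (Hd x).
  - intros [l Hl]. exists l. intros x Dx Ix. pose proof (proj1 (infinite_size_ge _) Ix) as Ix'.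
    destruct (Hl x Dx Ix') as (r & Hr & _ & R). eauto.
Qed.

Lemma cover_inf_transfer A B : equiv_on A -> equiv_on B -> bi_embeddable A B ->
  cover A (inf_class A) -> cover B (inf_class B).
Proof.
  intros EA EB H [l Hl].
  destruct (cover_transfer A B (fun _ => True) EA EB H) as [l' Hl'].
  - exists l. intros x Dx Hx. apply Hl; auto. intro n. now apply Hx.
  - exists l'. intros x Dx Hx. apply Hl'; auto.
Qed.

Lemma cover_size_transfer A B m : equiv_on A -> equiv_on B -> bi_embeddable A B ->
  cover A (fun x => size_ge (eq_class A x) m) -> cover B (fun x => size_ge (eq_class B x) m).
Proof.
  intros EA EB H [l Hl].
  destruct (cover_transfer A B (fun n => n = m) EA EB H) as [l' Hl'].
  - exists l. intros x Dx Hx. apply Hl; auto.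
  - exists l'. intros x Dx Hx. apply Hl'; auto. now intros n ->.
Qed.

Lemma unbounded_character_classes A :
  ~ bounded_character A -> unbounded_finite_classes A.
Proof.
  intros H n. apply NNPP. intro N. apply H. exists n. intros x Dx Fx.
  apply card_le_size_ge. intro Sx. apply N. exists x. split; [exact Dx|]. split.
  - intro I. now apply infinite_size_ge in I.
  - apply (size_ge_le _ _ (S n)); auto.
Qed.

Lemma inf_class_embedding B C f x :
  embedding B C f -> dom B x -> inf_class B x -> inf_class C (f x).
Proof. intros Hf Dx H n. now apply (size_ge_embedding B C). Qed.

(** The images of the finitely many infinite classes of [B] exhaust those of [C], so no finite class
    can be sent into an infinite one. *)
Lemma finite_class_embedding B C f g l x : equiv_on B -> equiv_on C ->
  embedding B C f -> embedding C B g -> reps B (inf_class B) l ->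
  dom B x -> inf_class C (f x) -> inf_class B x.
Proof.
  intros EB EC Hf Hg Hl Dx Ix.
  assert (Hl' : reps C (inf_class C) (map f l)).
  { apply (reps_map B C f g (inf_class B)); auto; intros z Dz.
    - now apply (inf_class_embedding B C).
    - now apply (inf_class_embedding C B). }
  destruct Hl' as (_ & _ & _ & Hc). destruct (Hc (f x)) as (r & Hr & R); auto.
  { now apply Hf. }
  apply in_map_iff in Hr. destruct Hr as (a & <- & Ha). destruct Hl as (_ & Hl & _).
  destruct (Hl a Ha) as [Da Ia]. intro n.
  apply (size_ge_class B a); auto. apply (proj1 (proj2 EB)); auto. apply Hf; auto.
Qed.

Lemma unbounded_transfer A B : equiv_on A -> equiv_on B -> bi_embeddable A B ->
  cover A (inf_class A) -> unbounded_finite_classes A -> unbounded_finite_classes B.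
Proof.
  intros EA EB [[f Hf] [g Hg]] Hc H n. apply cover_reps in Hc; [|exact EA]. destruct Hc as [l Hl].
  destruct (H n) as (x & Dx & Fx & Sx). exists (f x). split; [now apply Hf|]. split.
  - intro I. apply Fx. now apply (finite_class_embedding A B f g l).
  - now apply (size_ge_embedding A B).
Qed.

Lemma upper_bounded A : equivalence_structure A ->
  bounded_character A -> finitely_many_infinite_classes A -> computes_biemb A empty_set.
Proof.
  intros EqA [k Hk] HF. apply finitely_many_cover in HF; [|exact EqA].
  pose proof (equiv_structure_on A EqA) as EA.
  apply computes_biemb_intro; [exact EqA|]. intros B C EB EC HB HC.
  assert (BC : bi_embeddable B C)
    by (apply (bi_embeddable_trans B A); [now apply bi_embeddable_sym|exact HC]).
  (* The least size that only finitely many classes reach. It exists because a class with more than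
     [k] elements is infinite. *)
  destruct (least_nat (fun j => cover A (fun x => size_ge (eq_class A x) j)))
    as ([|m] & Hj & Hm).
  { exists (S k). destruct HF as [l Hl]. exists l. intros x Dx Sx. apply Hl; [exact Dx|].
    refine (proj1 (infinite_size_ge _) _). intro Fx.
    exact (proj1 (card_le_size_ge _ k) (Hk x Dx Fx) Sx). }
  (* Least size 0 means finitely many classes in all; every class is matched beforehand and no new
     one ever occurs. *)
  - apply (cover_size_transfer A B) in Hj; auto. destruct BC as [[f Hf] _].
    apply cover_reps in Hj; [|exact EB]. destruct Hj as [l Hl].
    destruct (embedding_from_reps B C _ f l (fun _ _ => True) EB EC Hl) as (g & Hg & Cg).
    + intros r Hr. destruct Hl as (_ & Hl & _). destruct (Hl r Hr) as [Dr _].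
      split; [now apply Hf|]. intro n. now apply size_ge_embedding.
    + intros r r' Hr Hr' R. destruct Hl as (_ & H2 & H3 & _). apply H3; auto.
      apply Hf; auto; now apply H2.
    + intros x Dx []. apply size_ge_0.
    + intros x y Dx []. apply size_ge_0.
    + exists g. split; [exact Hg|]. intros CB CC. apply Cg; auto. apply T_red_const.
  - apply (embedding_bounded B C m); auto.
    + now apply (cover_size_transfer A B).
    + intro H. apply (Hm m); [lia|]. apply (cover_size_transfer C A); auto.
      now apply bi_embeddable_sym.
Qed.

Lemma upper_unbounded A : equivalence_structure A ->
  ~ bounded_character A -> finitely_many_infinite_classes A -> computes_biemb A zero'.
Proof.
  intros EqA HU HF. apply finitely_many_cover in HF; [|exact EqA].
  pose proof (equiv_structure_on A EqA) as EA. apply unbounded_character_classes in HU.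
  apply computes_biemb_intro; [exact EqA|]. intros B C EB EC HB HC.
  assert (BC : bi_embeddable B C)
    by (apply (bi_embeddable_trans B A); [now apply bi_embeddable_sym|exact HC]).
  destruct BC as [[f Hf] _].
  destruct (cover_reps B (inf_class B) EB) as [l Hl]; [now apply (cover_inf_transfer A B)|].
  apply (embedding_unbounded B C f l); auto.
  - intros r Hr. destruct Hl as (_ & Hl & _). destruct (Hl r Hr) as [Dr Ir].
    split; [now apply Hf|]. now apply (inf_class_embedding B C).
  - intros r r' Hr Hr' R. destruct Hl as (_ & H2 & H3 & _). apply H3; auto.
    apply Hf; auto; now apply H2.
  - now apply (unbounded_transfer A C).
Qed.

Lemma upper_infinite A : equivalence_structure A ->
  ~ finitely_many_infinite_classes A -> computes_biemb A zero''.
Proof.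
  intros EqA HF. pose proof (equiv_structure_on A EqA) as EA.
  apply computes_biemb_intro; [exact EqA|]. intros B C EB EC HB HC.
  apply embedding_infinite; auto. intro H. apply HF, finitely_many_cover; auto.
  apply (cover_inf_transfer C A); auto. now apply bi_embeddable_sym.
Qed.

(** * Lower bound: unbounded character *)

Lemma list_function (l l' : list nat) : NoDup l -> NoDup l' -> length l = length l' ->
  exists f, (forall x, In x l -> In (f x) l') /\
    forall x y, In x l -> In y l -> f x = f y -> x = y.
Proof.
  revert l'. induction l as [|a l IH]; intros [|b l'] Hn Hn' E; try discriminate.
  - now exists id.
  - inversion_clear Hn as [|? ? Ha Hl]. inversion_clear Hn' as [|? ? Hb Hl'].
    destruct (IH l') as (f & Hf & Fi); auto.
    assert (T : forall x, In x (a :: l) -> x <> a -> In x l)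
      by (intros x [<-|Hx] N; [destruct N; reflexivity|exact Hx]).
    exists (fun x => if dec (x = a) then b else f x). split.
    + intros x Hx. destruct (dec (x = a)) as [->|N]; [now left|right; auto].
    + intros x y Hx Hy. destruct (dec (x = a)) as [->|Nx], (dec (y = a)) as [->|Ny]; auto;
        intro F; destruct Hb; [rewrite F|rewrite <- F]; auto.
Qed.

(** For unbounded character, finitely many infinite classes are counted by the only invariant left,
    so [A] can be traded for specially built copies. *)
Lemma bi_embeddable_unbounded B C lB lC : equiv_on B -> equiv_on C ->
  reps B (inf_class B) lB -> reps C (inf_class C) lC -> length lB = length lC ->
  unbounded_finite_classes B -> unbounded_finite_classes C -> bi_embeddable B C.
Proof.
  assert (H : forall B C lB lC, equiv_on B -> equiv_on C ->
    reps B (inf_class B) lB -> reps C (inf_class C) lC -> length lB = length lC ->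
    unbounded_finite_classes C -> embeds B C).
  { clear. intros B C lB lC EB EC HB (H1 & H2 & H3 & _) HL UC.
    destruct (list_function lB lC) as (f & Hf & Fi); auto; [apply HB|].
    destruct (embedding_unbounded B C f lB) as (g & Hg & _); auto; now exists g. }
  intros. split; eapply H; eauto.
Qed.

(** * Copies with prescribed finite classes *)

Section Standard.
Variables (k : nat) (D : nat -> nat -> Prop).
Hypothesis D_bounded : forall i, k <= i -> exists N, forall t, D i t -> t < N.
Hypothesis D_ge : forall i t, k <= i -> t <= i - k -> D i t.

Definition standard : structure :=
  Struct (fun z => pr1 z < k \/ D (pr1 z) (pr2 z)) (fun x y => pr1 x = pr1 y).

Lemma standard_equiv : equiv_on standard.
Proof. repeat split; simpl; intros; congruence. Qed.

(** The block may start at any [a], because the extra elements in [halting] begin only at the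
    halting time. *)
Lemma standard_size x a n :
  (forall t, a <= t -> t < a + n -> pr1 x < k \/ D (pr1 x) t) ->
  size_ge (eq_class standard x) n.
Proof.
  intro H. exists (map (fun t => ⟨pr1 x, t⟩) (seq a n)).
  rewrite length_map, length_seq. split; [|split; [reflexivity|]].
  - apply Injective_map_NoDup; [|apply seq_NoDup].
    intros t t' E. now apply pair_inj in E.
  - intros z Hz. apply in_map_iff in Hz. destruct Hz as (t & <- & Ht). apply in_seq in Ht.
    split; simpl; rewrite pr1_pair; [|reflexivity]. rewrite pr2_pair. now apply H.
Qed.

Lemma standard_size_le x N n : k <= pr1 x -> (forall t, D (pr1 x) t -> t < N) ->
  size_ge (eq_class standard x) n -> n <= N.
Proof.
  intros Hx HN Hn.
  pose proof (size_ge_bound _ n (map (fun t => ⟨pr1 x, t⟩) (seq 0 N)) Hn) as B.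
  rewrite length_map, length_seq in B. apply B. intros z [[Dz|Dz] Rz]; simpl in Rz; [lia|].
  apply in_map_iff. exists (pr2 z). rewrite Rz. split; [apply pair_pr|].
  apply in_seq. rewrite <- Rz in Dz. apply HN in Dz. lia.
Qed.

Lemma standard_inf x : inf_class standard x <-> pr1 x < k.
Proof.
  split.
  - intro H. destruct (Nat.lt_ge_cases (pr1 x) k) as [|L]; [assumption|].
    destruct (D_bounded _ L) as [N HN]. specialize (H (S N)).
    apply (standard_size_le x N) in H; auto. lia.
  - intros H n. apply (standard_size x 0). auto.
Qed.

Lemma standard_reps :
  reps standard (inf_class standard) (map (fun i => ⟨i, 0⟩) (seq 0 k)).
Proof.
  assert (H : forall r, In r (map (fun i => ⟨i, 0⟩) (seq 0 k)) -> pr1 r < k /\ r = ⟨pr1 r, 0⟩).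
  { intros r Hr. apply in_map_iff in Hr. destruct Hr as (i & <- & Hi).
    apply in_seq in Hi. rewrite pr1_pair. split; [lia|reflexivity]. }
  split; [|split; [|split]].
  - apply Injective_map_NoDup; [|apply seq_NoDup].
    intros t t' E. now apply pair_inj in E.
  - intros r Hr. destruct (H r Hr). split; [now left|]. now apply standard_inf.
  - intros r r' Hr Hr' E. destruct (H r Hr) as [_ ->], (H r' Hr') as [_ ->].
    simpl in E. now rewrite E.
  - intros x _ Ix. apply standard_inf in Ix. exists ⟨pr1 x, 0⟩. simpl. rewrite pr1_pair.
    split; [|reflexivity]. apply in_map_iff. exists (pr1 x). split; [reflexivity|].
    apply in_seq. lia.
Qed.

Lemma standard_unbounded : unbounded_finite_classes standard.
Proof.
  intro n. exists ⟨k + n, 0⟩. split; [|split].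
  - right. rewrite pr1_pair, pr2_pair. apply D_ge; lia.
  - rewrite standard_inf, pr1_pair. lia.
  - apply (standard_size _ 0). rewrite pr1_pair. intros t _ Ht. right. apply D_ge; lia.
Qed.

Lemma standard_bi_embeddable A l : equiv_on A -> reps A (inf_class A) l -> length l = k ->
  unbounded_finite_classes A -> bi_embeddable standard A.
Proof.
  intros EA Hl E UA. apply (bi_embeddable_unbounded _ _ _ l standard_equiv EA standard_reps);
    auto using standard_unbounded.
  now rewrite length_map, length_seq.
Qed.

Lemma standard_computable : T_red (fun z => D (pr1 z) (pr2 z)) (set_oracle empty_set) ->
  computable_structure standard.
Proof.
  intro HD. split; unfold computable_set; simpl; comp.
Qed.

End Standard.

Definition first_halt e s := halts (fun _ => 0) s e /\ forall m, m < s -> ~ halts (fun _ => 0) m e.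

Lemma first_halt_unique e s s' : first_halt e s -> first_halt e s' -> s = s'.
Proof.
  intros [H M] [H' M']. destruct (Nat.lt_trichotomy s s') as [L|[E|L]]; auto.
  - now apply M' in L.
  - now apply M in L.
Qed.

Definition plain k i t := t <= i - k.

(* Class [k + e] has at least [s + 1] elements when program [e] halts after [s] steps, so
   any bound on its size bounds the halting time. *)
Definition halting k i t :=
  t <= i - k \/ exists s, s < S t /\ first_halt (i - k) s /\ t <= 2 * s.

Lemma strong_degree_unbounded A : equivalence_structure A ->
  ~ bounded_character A -> finitely_many_infinite_classes A -> strong_BE_cat_degree A zero'.
Proof.
  intros EqA HU HF. pose proof (equiv_structure_on A EqA) as EA.
  pose proof (upper_unbounded A EqA HU HF) as Hup.
  apply finitely_many_cover in HF; [|exact EqA]. apply cover_reps in HF; [|exact EA].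
  destruct HF as [l Hl]. apply unbounded_character_classes in HU. set (k := length l).
  assert (P1 : forall i, k <= i -> exists N, forall t, plain k i t -> t < N)
    by (intros i _; exists (S (i - k)); unfold plain; intros; lia).
  assert (P2 : forall i t, k <= i -> t <= i - k -> plain k i t) by auto.
  assert (H1 : forall i, k <= i -> exists N, forall t, halting k i t -> t < N).
  { intros i _. destruct (classic (exists s, first_halt (i - k) s)) as [[s Hs]|N].
    - exists (S (i - k + 2 * s)). intros t [Ht|(s' & _ & Hs' & Ht)]; [lia|].
      rewrite (first_halt_unique _ _ _ Hs' Hs) in Ht. lia.
    - exists (S (i - k)). intros t [Ht|(s' & _ & Hs' & Ht)]; [lia|]. destruct N. eauto. }
  assert (H2 : forall i t, k <= i -> t <= i - k -> halting k i t) by (unfold halting; auto).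
  pose proof (T_red_halts0 (set_oracle empty_set)) as TH.
  apply (strong_degree_intro A _ (standard k (plain k)) (standard k (halting k))); auto.
  - apply standard_computable. unfold plain. comp.
  - apply standard_computable. unfold halting, first_halt. comp.
    all: apply (T_red_app2 _ (halts (fun _ => 0))); comp.
  - now apply (standard_bi_embeddable _ _ P1 P2 A l).
  - now apply (standard_bi_embeddable _ _ H1 H2 A l).
  - intros mu nu Hmu Hnu.
    (* The column hit by [nu] serves as a time bound: a finite column [i] of the plain copy has
       [i - k + 1] elements and must hold the [s + 1] elements that appear if [e] halts at [s]. *)
    assert (E : forall e, halts (fun _ => 0) (pr1 (nu ⟨k + e, 0⟩)) e <-> zero' e).
    { intro e. rewrite zero'_halts. split; [eauto|]. intro Hs. apply least_nat in Hs.
      destruct Hs as (s & Hs & Hm). apply (halts_mono _ s); [|exact Hs].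
      assert (Ss : size_ge (eq_class (standard k (halting k)) ⟨k + e, 0⟩) (S s)).
      { apply (standard_size _ _ _ s). rewrite pr1_pair. intros t Ht Ht'. right. right.
        exists s. replace (k + e - k) with e by lia. split; [lia|split; [now split|lia]]. }
      assert (D0 : dom (standard k (halting k)) ⟨k + e, 0⟩).
      { right. rewrite pr1_pair, pr2_pair. left. lia. }
      apply (size_ge_embedding _ _ nu _ _ Hnu D0) in Ss.
      apply standard_size_le with (N := S (pr1 (nu ⟨k + e, 0⟩) - k)) in Ss.
      - lia.
      (* An infinite target column would give no bound; the embedding [mu] in the other direction
         excludes it. *)
      - destruct (Nat.lt_ge_cases (pr1 (nu ⟨k + e, 0⟩)) k) as [L|]; [|assumption].
        apply (standard_inf _ _ P1) in L.
        apply (finite_class_embedding _ _ nu mu _ ⟨k + e, 0⟩ (standard_equiv _ _)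
          (standard_equiv _ _) Hnu Hmu (standard_reps _ _ H1) D0) in L.
        apply (standard_inf _ _ H1) in L. rewrite pr1_pair in L. lia.
      - unfold plain. intros. lia. }
    apply (T_red_ext _ _ _ E).
    apply (T_red_app2 _ (halts (fun _ => 0))); [apply T_red_halts0| |];
      pose proof (computes_join_right mu nu); comp.
Qed.

(** * Lower bound: infinitely many infinite classes *)

Definition stable n s b := s <= b -> halts (approx b) s n.

(* [v] encodes membership of [n] in [zero'']: [0] if not, and otherwise the successor of
   the least witness. Asking for the least one makes [v] unique. *)
Definition verdict n v :=
  (v = 0 -> forall s, exists b, ~ stable n s b) /\
  (v <> 0 -> (forall b, stable n (pred v) b) /\
    forall s, s < pred v -> exists b, ~ stable n s b).

Lemma verdict_exists n : exists v, verdict n v.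
Proof.
  destruct (classic (exists s, forall b, stable n s b)) as [H|N].
  - apply least_nat in H. destruct H as (s & Hs & Hm). exists (S s). split; [easy|].
    intros _. split; [exact Hs|]. intros m Lm. apply not_all_ex_not, Hm, Lm.
  - exists 0. split; [|tauto]. intros _ s. apply not_all_ex_not. eauto.
Qed.

Lemma verdict_unique n v v' : verdict n v -> verdict n v' -> v = v'.
Proof.
  assert (H : forall v v', verdict n v -> verdict n v' -> v < v' -> False).
  { clear. intros v v' [H0 HS] [_ HS'] L. destruct HS' as [Hs' Hm']; [lia|].
    destruct v as [|v].
    - destruct (H0 eq_refl (pred v')) as [b Hb]. apply Hb, Hs'.
    - destruct HS as [Hs _]; [lia|]. destruct (Hm' v) as [b Hb]; [lia|]. apply Hb, Hs. }
  intros Hv Hv'. destruct (Nat.lt_trichotomy v v') as [L|[E|L]]; auto; exfalso; eauto.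
Qed.

Lemma verdict_zero'' n v : verdict n v -> (zero'' n <-> v <> 0).
Proof.
  intros [H0 HS]. rewrite zero''_sigma2. fold (stable n). split.
  - intros [s Hs] E. destruct (H0 E s) as [b Hb]. apply Hb. exact (Hs b).
  - intro N. exists (pred v). apply (HS N).
Qed.

(** The zero tail after [n] entries makes a code unique among those with the same entries, which
    [correct_unique] depends on. *)
Definition code_of_length n c := Nat.iter n (fun r => pr2 r) c = 0.

Lemma code_exists n g :
  exists c, code_of_length n c /\ forall i, i < n -> nthc c i = g i.
Proof.
  revert g. induction n as [|n IH]; intro g; [exists 0; split; [reflexivity|lia]|].
  destruct (IH (fun i => g (S i))) as (c & Hc & Hg). exists ⟨g 0, c⟩. split.
  - unfold code_of_length. now rewrite Nat.iter_succ_r, pr2_pair.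
  - intros [|i] Hi; unfold nthc; [simpl; apply pr1_pair|].
    rewrite Nat.iter_succ_r, pr2_pair. apply Hg. lia.
Qed.

Lemma code_unique n c c' : code_of_length n c -> code_of_length n c' ->
  (forall i, i < n -> nthc c i = nthc c' i) -> c = c'.
Proof.
  unfold code_of_length. revert c c'. induction n as [|n IH]; intros c c' Hc Hc' H;
    [simpl in *; congruence|].
  rewrite Nat.iter_succ_r in Hc, Hc'. rewrite <- (pair_pr c), <- (pair_pr c').
  rewrite (IH (pr2 c) (pr2 c') Hc Hc').
  - do 2 f_equal. apply (H 0). lia.
  - intros i Hi. specialize (H (S i)). unfold nthc in H. rewrite !Nat.iter_succ_r in H.
    apply H. lia.
Qed.

(* [w = ⟨n, c⟩] lists [n] candidate verdicts in [c]. That all of them are correct is a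
   Pi2 condition [forall a, exists b, confirms w a b]. *)
Definition confirms w a b :=
  code_of_length (pr1 w) (pr2 w) /\
  (pr1 a < pr1 w ->
    (nthc (pr2 w) (pr1 a) = 0 -> ~ stable (pr1 a) (pr2 a) b) /\
    (nthc (pr2 w) (pr1 a) <> 0 -> stable (pr1 a) (pred (nthc (pr2 w) (pr1 a))) (pr2 a) /\
      (pr2 a < pred (nthc (pr2 w) (pr1 a)) -> ~ stable (pr1 a) (pr2 a) b))).

Definition correct w := code_of_length (pr1 w) (pr2 w) /\
  forall i, i < pr1 w -> verdict i (nthc (pr2 w) i).

(** [pr1 a] is the position checked, while [pr2 a] has two universal roles: a possible witness to be
    refuted, and a stage at which the claimed witness is tested. *)
Lemma confirms_correct w : (forall a, exists b, confirms w a b) <-> correct w.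
Proof.
  split.
  - intro H. split; [destruct (H 0) as [b Hb]; apply Hb|]. intros i Hi.
    assert (H' : forall s, exists b, confirms w ⟨i, s⟩ b) by auto.
    unfold confirms in H'. split.
    + intros E s. destruct (H' s) as (b & _ & Hb). exists b.
      rewrite pr1_pair, pr2_pair in Hb. exact (proj1 (Hb Hi) E).
    + intro N. split.
      * intro s. destruct (H' s) as (b & _ & Hb). rewrite pr1_pair, pr2_pair in Hb.
        apply (proj2 (Hb Hi) N).
      * intros s Hs. destruct (H' s) as (b & _ & Hb). exists b.
        rewrite pr1_pair, pr2_pair in Hb. now apply (proj2 (Hb Hi) N).
  - intros [Hc Hv] a. destruct (Nat.lt_ge_cases (pr1 a) (pr1 w)) as [L|L].
    + destruct (Hv _ L) as [H0 HS].
      destruct (Nat.eq_dec (nthc (pr2 w) (pr1 a)) 0) as [E|N].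
      * destruct (H0 E (pr2 a)) as [b Hb]. exists b. split; [exact Hc|]. intros _. tauto.
      * destruct (HS N) as [Hs Hm].
        destruct (Nat.lt_ge_cases (pr2 a) (pred (nthc (pr2 w) (pr1 a)))) as [L'|L'].
        -- destruct (Hm _ L') as [b Hb]. exists b. split; [exact Hc|]. intros _.
           split; [tauto|]. auto.
        -- exists 0. split; [exact Hc|]. intros _. split; [tauto|]. split; [auto|lia].
    + exists 0. split; [exact Hc|lia].
Qed.

Lemma correct_exists n : exists w, pr1 w = n /\ correct w.
Proof.
  destruct (code_exists n (fun i => epsilon (inhabits 0) (verdict i))) as (c & Hc & Hv).
  exists ⟨n, c⟩. unfold correct. rewrite pr1_pair, pr2_pair.
  split; [reflexivity|split; [exact Hc|]]. intros i Hi. rewrite (Hv i Hi).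
  apply epsilon_spec, verdict_exists.
Qed.

(** Hence different infinite classes of [guesses] carry lists of different lengths, and infinitely
    many of them carry arbitrarily long lists. *)
Lemma correct_unique w w' : pr1 w = pr1 w' -> correct w -> correct w' -> w = w'.
Proof.
  intros E [Hc Hv] [Hc' Hv']. rewrite <- (pair_pr w), <- (pair_pr w').
  rewrite <- E in *. do 2 f_equal. apply (code_unique (pr1 w)); auto.
  intros i Hi. apply (verdict_unique i); auto.
Qed.

(** * The copy whose infinite classes carry correct verdicts *)

Definition reached w a t := forall a', a' < S a -> exists b, b < S t /\ confirms w a' b.

(* Class [w] receives one element [⟨w, ⟨a, t⟩⟩] for each [a] such that
   [exists b, confirms w a' b] holds for all [a' <= a]. *)
Definition guesses : structure := Struct
  (fun z => reached (pr1 z) (pr1 (pr2 z)) (pr2 (pr2 z)) /\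
    forall t, t < pr2 (pr2 z) -> ~ reached (pr1 z) (pr1 (pr2 z)) t)
  (fun x y => pr1 x = pr1 y).

Lemma guesses_equiv : equiv_on guesses.
Proof. repeat split; simpl; intros; congruence. Qed.

Lemma reached_exists w a : correct w ->
  exists t, reached w a t /\ forall m, m < t -> ~ reached w a m.
Proof.
  intro H. apply least_nat. pose proof (proj2 (confirms_correct w) H) as Hb. clear H.
  induction a as [|a [t IH]].
  - destruct (Hb 0) as [b H]. exists b. intros a' Ha. exists b.
    replace a' with 0 by lia. auto.
  - destruct (Hb (S a)) as [b H]. exists (t + b). intros a' Ha.
    destruct (Nat.eq_dec a' (S a)) as [->|].
    + exists b. split; [lia|exact H].
    + destruct (IH a') as (b' & Lb & H'); [lia|]. exists b'. split; [lia|exact H'].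
Qed.

Lemma guesses_inf x : inf_class guesses x <-> correct (pr1 x).
Proof.
  split.
  - intro H. apply confirms_correct. intro a. apply NNPP. intro N.
    (* If nothing confirms [a], all elements of the class have indices below [a], and each index has
       at most one element because [t] is least. *)
    destruct (H (S a)) as (l & Hl & El & HP).
    assert (length l <= length (seq 0 a)); [|rewrite length_seq in *; lia].
    apply (pigeonhole _ _ (fun a y => pr1 (pr2 y) = a)); [exact Hl| |].
    + intros y Hy. exists (pr1 (pr2 y)). split; [|reflexivity]. apply in_seq.
      destruct (HP y Hy) as [[R _] E]. simpl in E.
      destruct (Nat.lt_ge_cases (pr1 (pr2 y)) a) as [|L]; [lia|].
      destruct N. destruct (R a) as (b & _ & Hb); [lia|]. exists b. now rewrite E.
    + intros c y y' Hy Hy' E E'. destruct (HP y Hy) as [[R M] F], (HP y' Hy') as [[R' M'] F'].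
      simpl in F, F'. rewrite <- F, E in R, M. rewrite <- F', E' in R', M'.
      assert (T : pr2 (pr2 y) = pr2 (pr2 y')).
      { destruct (Nat.lt_trichotomy (pr2 (pr2 y)) (pr2 (pr2 y'))) as [L|[L|L]]; auto.
        - now apply M' in L.
        - now apply M in L. }
      rewrite <- (pair_pr y), <- (pair_pr y'), <- (pair_pr (pr2 y)), <- (pair_pr (pr2 y')).
      congruence.
  - intros H n.
    assert (T : exists f, forall a, reached (pr1 x) a (f a) /\
      forall m, m < f a -> ~ reached (pr1 x) a m).
    { exists (fun a => proj1_sig (constructive_indefinite_description _ (reached_exists _ a H))).
      intro a. now destruct (constructive_indefinite_description _ _). }
    destruct T as [f Hf]. exists (map (fun a => ⟨pr1 x, ⟨a, f a⟩⟩) (seq 0 n)).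
    rewrite length_map, length_seq. split; [|split; [reflexivity|]].
    + apply Injective_map_NoDup; [|apply seq_NoDup].
      intros t t' E. apply pair_inj in E. destruct E as [_ E]. now apply pair_inj in E.
    + intros z Hz. apply in_map_iff in Hz. destruct Hz as (a & <- & _).
      split; simpl; rewrite ?pr1_pair, ?pr2_pair, ?pr1_pair, ?pr2_pair; [apply Hf|reflexivity].
Qed.

Lemma guesses_cover : ~ cover guesses (inf_class guesses).
Proof.
  (* A correct list longer than all those indexing the classes in [l] gives an infinite class
     outside the cover. *)
  intros [l Hl]. pose (n := S (list_max (map (fun r => pr1 (pr1 r)) l))).
  destruct (correct_exists n) as (w & Hw & Cw).
  destruct (reached_exists w 0 Cw) as [t Ht].
  destruct (Hl ⟨w, ⟨0, t⟩⟩) as (r & Hr & _ & R).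
  - simpl. now rewrite pr1_pair, !pr2_pair, pr1_pair.
  - apply guesses_inf. now rewrite pr1_pair.
  - simpl in R. rewrite pr1_pair in R.
    pose proof (proj1 (list_max_le (map (fun r => pr1 (pr1 r)) l) _) (le_n _)) as F.
    rewrite Forall_forall in F.
    assert (L : pr1 (pr1 r) <= list_max (map (fun r => pr1 (pr1 r)) l)).
    { apply F, in_map_iff. eauto. }
    rewrite <- R, Hw in L. unfold n in L. lia.
Qed.

Lemma guesses_computable : computable_structure guesses.
Proof.
  pose proof (T_red_halts_approx (set_oracle empty_set)) as TH.
  assert (TS : T_red (fun z => stable (pr1 z) (pr1 (pr2 z)) (pr2 (pr2 z)))
    (set_oracle empty_set)).
  { unfold stable. comp. apply (T_red_app3 _ (fun b s n => halts (approx b) s n)); comp. }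
  assert (TC : T_red (fun z => confirms (pr1 z) (pr1 (pr2 z)) (pr2 (pr2 z)))
    (set_oracle empty_set)).
  { unfold confirms, code_of_length, nthc. comp; apply (T_red_app3 _ stable); comp. }
  assert (TG : T_red (fun z => reached (pr1 z) (pr1 (pr2 z)) (pr2 (pr2 z))) (set_oracle empty_set)).
  { unfold reached. comp. apply (T_red_app3 _ confirms); comp. }
  split; unfold computable_set; simpl; comp; apply (T_red_app3 _ reached); comp.
Qed.

(** With only infinite classes in the source, an embedding into [guesses] must send each column to a
    correct list. *)
Definition all_infinite : structure := Struct (fun _ => True) (fun x y => pr1 x = pr1 y).

Lemma all_infinite_equiv : equiv_on all_infinite.
Proof. repeat split; simpl; intros; congruence. Qed.

Lemma all_infinite_inf x : inf_class all_infinite x.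
Proof.
  intro n. exists (map (fun t => ⟨pr1 x, t⟩) (seq 0 n)).
  rewrite length_map, length_seq. split; [|split; [reflexivity|]].
  - apply Injective_map_NoDup; [|apply seq_NoDup].
    intros t t' E. now apply pair_inj in E.
  - intros z Hz. apply in_map_iff in Hz. destruct Hz as (t & <- & Ht).
    split; simpl; [exact I|]. now rewrite pr1_pair.
Qed.

Lemma all_infinite_cover : ~ cover all_infinite (inf_class all_infinite).
Proof.
  intros [l Hl].
  destruct (Hl ⟨S (list_max (map (fun r => pr1 r) l)), 0⟩ I) as (r & Hr & _ & R);
    [apply all_infinite_inf|].
  simpl in R. rewrite pr1_pair in R.
  pose proof (proj1 (list_max_le (map (fun r => pr1 r) l) _) (le_n _)) as F.
  rewrite Forall_forall in F.
  assert (L : pr1 r <= list_max (map (fun r => pr1 r) l)) by (apply F, in_map_iff; eauto).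
  lia.
Qed.

Lemma bi_embeddable_infinite B C : equiv_on B -> equiv_on C ->
  ~ cover B (inf_class B) -> ~ cover C (inf_class C) -> bi_embeddable B C.
Proof.
  intros EB EC HB HC. split.
  - destruct (embedding_infinite B C EB EC HC) as (g & Hg & _). now exists g.
  - destruct (embedding_infinite C B EC EB HB) as (g & Hg & _). now exists g.
Qed.

Lemma strong_degree_infinite A : equivalence_structure A ->
  ~ finitely_many_infinite_classes A -> strong_BE_cat_degree A zero''.
Proof.
  intros EqA HF. pose proof (equiv_structure_on A EqA) as EA.
  pose proof (upper_infinite A EqA HF) as Hup.
  rewrite (finitely_many_cover A EqA) in HF.
  apply (strong_degree_intro A _ all_infinite guesses Hup).
  - split; unfold computable_set; simpl; comp.
  - apply guesses_computable.
  - apply bi_embeddable_infinite; auto using all_infinite_equiv, all_infinite_cover.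
  - apply bi_embeddable_infinite; auto using guesses_equiv, guesses_cover.
  - intros mu nu Hmu _. set (w := fun j => pr1 (mu ⟨j, 0⟩)).
    assert (Cw : computes (join_oracle mu nu) w).
    { unfold w. pose proof (computes_join_left mu nu). comp. }
    assert (Hw : forall j, correct (w j)).
    { intro j. apply guesses_inf. apply (inf_class_embedding all_infinite); auto.
      - exact I.
      - apply all_infinite_inf. }
    assert (Hi : forall j j', pr1 (w j) = pr1 (w j') -> j = j').
    { intros j j' E. apply correct_unique in E; auto.
      apply (proj2 (proj2 Hmu) ⟨j, 0⟩ ⟨j', 0⟩ I I) in E. simpl in E.
      now rewrite !pr1_pair in E. }
    (* The lengths are pairwise distinct, so [i + 2] columns cannot all have lengths among the
       [i + 1] values up to [i]. *)
    assert (Hex : forall i, exists j, i < pr1 (w j)).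
    { intro i. apply NNPP. intro N.
      assert (length (seq 0 (S (S i))) <= length (seq 0 (S i))); [|rewrite !length_seq in *; lia].
      apply (pigeonhole _ _ (fun a j => pr1 (w j) = a)); [apply seq_NoDup| |].
      - intros j _. exists (pr1 (w j)). split; [|reflexivity]. apply in_seq.
        destruct (Nat.lt_ge_cases i (pr1 (w j))); [|lia]. destruct N. eauto.
      - intros a j j' _ _ E E'. apply Hi. congruence. }
    destruct (computes_search (join_oracle mu nu) (fun i j => i < pr1 (w j))) as (f & Cf & Hf);
      [comp|exact Hex|].
    (* A correct list longer than [i] is found by search, and its entry at [i] is nonzero exactly
       when [i] lies in [zero'']. *)
    apply (T_red_ext _ (fun i => ~ nthc (pr2 (w (f i))) i = 0)).
    + intro i. symmetry. apply verdict_zero''. now apply (Hw (f i)).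
    + unfold nthc. comp.
Qed.

Lemma strong_degree_bounded A : computable_structure A -> equivalence_structure A ->
  bounded_character A -> finitely_many_infinite_classes A -> strong_BE_cat_degree A empty_set.
Proof.
  intros CA EqA HB HF.
  assert (R : bi_embeddable A A) by (split; exists id; repeat split; auto).
  apply (strong_degree_intro A _ A A); auto using upper_bounded.
  intros mu nu _ _. apply T_red_const.
Qed.

Theorem theorem1p3 (A : structure) :
  computable_structure A -> equivalence_structure A ->
  (bounded_character A -> finitely_many_infinite_classes A ->
     strong_BE_cat_degree A empty_set) /\
  (~ bounded_character A -> finitely_many_infinite_classes A ->
     strong_BE_cat_degree A zero') /\
  (~ finitely_many_infinite_classes A ->
     strong_BE_cat_degree A zero'').
Proof.
  intros CA EqA. split; [|split].
  - now apply strong_degree_bounded.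
  - now apply strong_degree_unbounded.
  - now apply strong_degree_infinite.
Qed.
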